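(* Let ${\mathscr X}$ be a Polish space with countable basis ${\mathscr U}$, let $\hat{\mathscr X}$ be the associated zero-dimensional refinement, and let ${\mathscr A}$ be a set of finite partitions generated by ${\mathscr U}$, directed under refinement, that resolves ${\mathscr X}$. Equip $M^1({\mathscr X})$ with the tight topology. Let $(\Pi_\alpha)_{\alpha\in{\mathscr A}}$ be a coherent system of Borel probability measures on the simplices $M^1({\mathscr X}_\alpha)$. Then there exists a unique Radon probability measure $\Pi$ on $M^1({\mathscr X})$ projecting to $\Pi_\alpha$ for all $\alpha\in{\mathscr A}$ if and only if for every $\epsilon,\delta>0$ there is a compact $\hat K\subset\hat{\mathscr X}$ such that $$\Pi_\alpha\Bigl(\Bigl\{P_\alpha\in M^1({\mathscr X}_\alpha):\sum_{A\in\alpha,\;A\cap\hat K\neq\emptyset}P_\alpha(A)<1-\delta\Bigr\}\Bigr)<\epsilon\quad\text{for all }\alpha\in{\mathscr A}.$$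
   Context: $\hat{\mathscr X}$: the set ${\mathscr X}$ with topology generated by the subbasis $\{U,{\mathscr X}\setminus U:U\in{\mathscr U}\}$. A partition $\alpha$ (finite collection of non-empty disjoint Borel sets covering ${\mathscr X}$) is generated by ${\mathscr U}$ if each $A\in\alpha$ is a finite union of finite intersections of sets $U$ or ${\mathscr X}\setminus U$, $U\in{\mathscr U}$. ${\mathscr A}$ resolves ${\mathscr X}$ if its partition sets generate the Borel $\sigma$-algebra. $M^1({\mathscr X})$: Radon probability measures; tight topology: coarsest making $P\mapsto\int f\,dP$ continuous for all bounded continuous $f$. $M^1({\mathscr X}_\alpha)$: simplex of probability vectors $(P_\alpha(A))_{A\in\alpha}$; projection $P\mapsto(P(A))_{A\in\alpha}$. Coherence: $\Pi_\alpha=\Pi_\beta\circ\varphi_{\alpha\beta}^{-1}$ for $\alpha\le\beta$ where $(\varphi_{\alpha\beta}p)_A=\sum_{B\in\beta,B\subset A}p_B$. $\Pi$ projects to $\Pi_\alpha$ if $\Pi_\alpha$ is the law of $(P(A))_{A\in\alpha}$ under $P\sim\Pi$. *)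

(* Defs.v *)
From HB Require Import structures.
Set Warnings "-notation-overridden -notation-incompatible-prefix -ambiguous-paths -notation-overriden".

From mathcomp Require Import all_boot all_order all_algebra finmap.
From mathcomp Require Import all_classical all_reals all_analysis.

Set Implicit Arguments.
Unset Strict Implicit.
Unset Printing Implicit Defensive.

Import Order.TTheory GRing.Theory Num.Theory numFieldNormedType.Exports.
Local Open Scope classical_set_scope.
Local Open Scope ring_scope.

Definition polish (R : realType) (T : topologicalType) : Prop :=
  (exists2 D : set T, countable D & closure D = setT) /\
  exists d : T -> T -> R,
    [/\ (forall x y, 0 <= d x y),
        (forall x y, d x y = 0 <-> x = y),
        (forall x y, d x y = d y x /\ forall z, d x z <= d x y + d y z),
        (forall A : set T, open A <->
            (forall x, A x -> exists2 e : R, 0 < e & [set y | d x y < e] `<=` A))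
      & (forall u : nat -> T,
           (forall e : R, 0 < e -> exists N : nat, forall m n : nat,
               (N <= m)%N -> (N <= n)%N -> d (u m) (u n) < e) ->
           exists l : T, u @ \oo --> l)].

Definition borel (T : ptopologicalType) := g_sigma_algebraType (@open T).

Definition radon (R : realType) (T : ptopologicalType)
    (P : probability (borel T) R) : Prop :=
  forall B : set T, <<s @open T >> B ->
    P B = ereal_sup [set P K | K in [set K : set T | compact K /\ K `<=` B]].

Lemma radon_dirac (R : realType) (T : ptopologicalType) :
  radon (@dirac _ (borel T) (point : borel T) R : probability (borel T) R).
Proof.
move=> B _ /=; rewrite diracE.
have [Bp|nBp] := pselect (B point).
  rewrite mem_set //; apply/esym/eqP; rewrite eq_le; apply/andP; split.
    apply: ge_ereal_sup => _ [K _ <-]; rewrite diracE.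
    by case: (point \in K); rewrite ?lee01 // lexx.
  apply: ereal_sup_ubound; exists [set point].
    split; first exact: compact_set1.
    by move=> x ->.
  by rewrite diracE mem_set.
rewrite memNset //; apply/esym/eqP; rewrite eq_le; apply/andP; split.
  apply: ge_ereal_sup => _ [K [_ KB] <-]; rewrite diracE memNset //.
  by move=> /KB.
apply: ereal_sup_ubound; exists set0.
  by split; [exact: compact0| ].
by rewrite diracE memNset.
Qed.

Definition M1 (R : realType) (T : ptopologicalType) :=
  {P : probability (borel T) R | radon P}.

HB.instance Definition _ (R : realType) (T : ptopologicalType) :=
  gen_eqMixin (M1 R T).
HB.instance Definition _ (R : realType) (T : ptopologicalType) :=
  gen_choiceMixin (M1 R T).
HB.instance Definition _ (R : realType) (T : ptopologicalType) :=
  isPointed.Build (M1 R T) (exist _ _ (@radon_dirac R T)).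

Definition bcont (R : realType) (T : topologicalType) :=
  {f : T -> R | continuous f /\ exists M : R, forall x, `|f x| <= M}.

Definition integ (R : realType) (T : ptopologicalType) (f : bcont R T)
    (P : M1 R T) : R :=
  fine (\int[sval P]_x (sval f x)%:E).

Definition M1t (R : realType) (T : ptopologicalType) :=
  sup_topology (fun f : bcont R T =>
    Topological.class (initial_topology (integ f))).


Definition hat_subbase (T : Type) (U : set (set T)) : set (set T) :=
  [set V | U V \/ exists2 W, U W & V = ~` W].

Definition hatX (T : Type) (U : set (set T)) : Type := T.
HB.instance Definition _ (T : choiceType) (U : set (set T)) :=
  Choice.on (hatX U).
HB.instance Definition _ (T : choiceType) (U : set (set T)) :=
  isSubBaseTopological.Build (hatX U) (hat_subbase U) id.


Definition Rvec (R : realType) (I : Type) : Type := I -> R.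
HB.instance Definition _ (R : realType) (I : Type) :=
  Topological.copy (Rvec R I) {ptws I -> R}.
HB.instance Definition _ (R : realType) (I : Type) :=
  Pointed.copy (Rvec R I) (I -> R).

Section Partitions.
Local Unset Implicit Arguments.
Context {R : realType} {T : ptopologicalType}.

Definition literal (U : set (set T)) (L : set T) : Prop :=
  U L \/ exists2 W, U W & L = ~` W.

Definition generated_by (U : set (set T)) (A : set T) : Prop :=
  exists s : seq (seq (set T)),
    (forall l, l \in s -> forall L, L \in l -> literal U L) /\
    A = \big[setU/set0]_(l <- s) \big[setI/setT]_(L <- l) L.

Definition is_partition (a : {fset (set T)}) : Prop :=
  [/\ forall A : a, fsval A !=set0,
      forall A : a, <<s @open T >> (fsval A),
      forall A B : a, A != B -> fsval A `&` fsval B = set0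
    & \bigcup_(A in [set: a]) fsval A = setT].

Definition partition_generated_by (U : set (set T)) (a : {fset (set T)}) :=
  forall A : a, generated_by U (fsval A).

(** a <= b : b refines a (every B in b is contained in some A in a) *)
Definition refines (a b : {fset (set T)}) : Prop :=
  forall B : b, exists A : a, fsval B `<=` fsval A.

Definition directed (As : set {fset (set T)}) : Prop :=
  As !=set0 /\
  forall a b, As a -> As b -> exists2 c, As c & refines a c /\ refines b c.

Definition resolves (As : set {fset (set T)}) : Prop :=
  <<s [set A | exists2 a, As a & exists B : a, fsval B = A] >> =
  <<s @open T >>.

Definition simplex (a : {fset (set T)}) : set (Rvec R a) :=
  [set p | (forall A : a, 0 <= p A) /\ \sum_(A : a) p A = 1].

Definition vecof (a : {fset (set T)}) (P : M1t R T) : Rvec R a :=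
  fun A : a => fine (sval (P : M1 R T) (fsval A)).

Definition phi (a b : {fset (set T)}) (q : Rvec R b) : Rvec R a :=
  fun A : a => \sum_(B : b | `[< fsval B `<=` fsval A >]) q B.

Definition coherent (As : set {fset (set T)})
    (Pi : forall a : {fset (set T)}, probability (borel (Rvec R a)) R) :=
  forall a b, As a -> As b -> refines a b ->
    forall S : set (Rvec R a), <<s @open (Rvec R a) >> S ->
      Pi a S = Pi b [set q | S (phi a b q)].

Definition projects (Pi_ : probability (borel (M1t R T)) R)
    (As : set {fset (set T)})
    (Pi : forall a : {fset (set T)}, probability (borel (Rvec R a)) R) :=
  forall a, As a ->
    forall S : set (Rvec R a), <<s @open (Rvec R a) >> S ->
      Pi a S = Pi_ [set P : M1t R T | S (vecof a P)].

End Partitions.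

(* Main.v *)
Require Import Defs.
From HB Require Import structures.
Set Warnings "-notation-overridden -notation-incompatible-prefix -ambiguous-paths".
From mathcomp Require Import all_boot all_order all_algebra finmap.
From mathcomp Require Import all_classical all_reals all_analysis.
From mathcomp Require Import measurable_realfun lra.
Import Order.TTheory GRing.Theory Num.Theory numFieldNormedType.Exports.
Set Implicit Arguments.
Unset Strict Implicit.
Unset Printing Implicit Defensive.
Local Open Scope classical_set_scope.
Local Open Scope ring_scope.

(** Necessity: the barycentre A |-> int P(A) dPi is a Borel probability on X, which
    is tight for the topology of the refinement, and Markov's inequality turns its
    tightness into the bound on the Pi_alpha.

    Sufficiency: since the basis is countable there are only countably many
    partitions, so a chain b_0 <= b_1 <= ... is cofinal. The Pi_{b_n} define a
    finitely additive content on the cylinders of M^1(X). Let cylinders C_k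
    decrease with content bounded below. Approximating them from inside by closed
    cylinders and discarding measures that violate the tightness bounds gives, for
    each N, a measure P_N in C_N that is nearly concentrated on K_0, ..., K_N, up
    to the partition b_N. An ultrafilter limit of the P_N is a finitely additive
    probability on the algebra generated by the partitions; the pieces are clopen
    in the refinement and the K_j are compact there, so it is countably additive,
    and its extension lies in every C_k. Hence Caratheodory's theorem produces Pi.
    The same limit argument on the algebra of all clopen Borel sets is Prokhorov's
    theorem: { P : P(K_j) >= 1 - 1/(j+1) for all j } is compact, whence Pi is
    Radon. Uniqueness holds because the tight topology is second countable and its
    Borel sets are generated by the cylinders. *)

(** * Extension of finitely additive probabilities *)

(** The obstacle is that a piece A of a partition is clopen only in the refinement: for the tight
    topology P |-> P(A) is Borel but in general not continuous, so closed cylinders need not be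
    closed, and compactness inside M^1(X) cannot decide whether they intersect. Limits are therefore
    taken set by set on an algebra of clopen sets. Two such algebras occur: the one generated by the
    partitions is what the cylinders see, while the one of all clopen Borel sets contains the basis
    and so controls tight convergence. A partition does not see a compact K, only its hull, the
    union of the pieces that meet K. Along the chain the hulls decrease to K, which turns bounds on
    the Pi_alpha into bounds on P(K). *)

Lemma subset_decreasing (T : Type) (A : nat -> set T) :
  (forall n, A n.+1 `<=` A n) -> forall m n, (m <= n)%N -> A n `<=` A m.
Proof.
move=> dA m; elim=> [|n IH]; first by rewrite leqn0 => /eqP ->.
rewrite leq_eqVlt => /predU1P[-> //|]; rewrite ltnS => /IH.
by apply: subset_trans; exact: dA.
Qed.

Definition set_algebra (T : Type) (G : set (set T)) :=
  [/\ G set0, setU_closed G & setC_closed G].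

Section set_algebra_type.
Context (T : pointedType) (G : set (set T)) (Galg : set_algebra G).

(* The alias mentions the proof [Galg] so that the structure depending on it can be
   inferred from the type. *)
Definition set_algebra_type : Type := let _ := Galg in T.

HB.instance Definition _ := Pointed.copy set_algebra_type T.

Let G0 : G set0. Proof. by case: Galg. Qed.
Let GU : setU_closed G. Proof. by case: Galg. Qed.
Let GC : setC_closed G. Proof. by case: Galg. Qed.

HB.instance Definition _ := @isAlgebraOfSets.Build (sigma_display G)
  set_algebra_type G G0 GU GC.

End set_algebra_type.

Section algebra_extension.
Context (R : realType) (T : pointedType) (G H : set (set T)) (p : set T -> R).
Hypotheses (Galg : set_algebra G) (HG : <<s H >> = <<s G >>).
Hypotheses (p0 : forall A, G A -> 0 <= p A) (pT : p setT = 1).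
Hypothesis pU : forall A B, G A -> G B -> A `&` B = set0 ->
  p (A `|` B) = p A + p B.
Hypothesis pcont : forall A : nat -> set T, (forall n, G (A n)) ->
  (forall n, A n.+1 `<=` A n) -> \bigcap_n A n = set0 ->
  forall e, 0 < e -> exists n, p (A n) < e.

Let X := set_algebra_type Galg.
Let mu (A : set X) : \bar R := if `[< G A >] then (p A)%:E else 0%E.

Let muE A : G A -> mu A = (p A)%:E.
Proof. by move=> GA; rewrite /mu asboolT. Qed.

Let ps0 : p set0 = 0.
Proof.
have [G0 _ _] := Galg.
have := pU G0 G0 (setI0 _); rewrite setU0 => /eqP.
by rewrite -subr_eq subrr eq_sym => /eqP.
Qed.

Let mu_ge0 (A : set X) : (0 <= mu A)%E.
Proof. by rewrite /mu; case: asboolP => // GA; rewrite lee_fin p0. Qed.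

Let mu_additive : measure_function.semi_additive mu.
Proof.
have [G0 GU GC] := Galg.
apply/additive2P; first by rewrite muE // ps0.
by move=> A B GA GB AB; rewrite !muE ?pU //; exact: GU.
Qed.

HB.instance Definition _ := isContent.Build _ X R mu mu_ge0 mu_additive.

Let muT_fin (A : set X) : G A -> mu A \is a fin_num.
Proof. by move=> GA; rewrite muE. Qed.

Let mu_sigma_additive : semi_sigma_additive mu.
Proof.
have [G0 GU GC] := Galg.
move=> F mF tF mUF.
(* Continuity at the empty set gives countable additivity: the partial sums miss only the mass of
   the tails [D n], which lie in the algebra and decrease to the empty set. *)
pose D n : set X := (\bigcup_k F k) `\` \big[setU/set0]_(i < n) F i.
have GS n : measurable (\big[setU/set0]_(i < n) F i : set X).
  exact: bigsetU_measurable.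
have GD n : measurable (D n) by exact: measurableD.
have SUb n : \big[setU/set0]_(i < n) F i `<=` \bigcup_k F k.
  exact: bigsetU_bigcup.
have sumE n : (\sum_(0 <= i < n) mu (F i) = mu (\bigcup_k F k) - mu (D n))%E.
  have := @measureU _ _ _ mu (\big[setU/set0]_(i < n) F i) (D n) (GS n) (GD n).
  rewrite setDIK => /(_ erefl).
  rewrite setDUK // => ->.
  rewrite addeK ?muT_fin //; last exact: GD.
  rewrite measure_semi_additive_ord_I //.
  by rewrite big_mkord.
  exact: sub_trivIset tF.
have D0 : \bigcap_n D n = set0.
  rewrite -subset0 => x Dx.
  have [[k _ Fkx] _] := Dx 0%N I.
  have [_] := Dx k.+1 I; apply; rewrite big_ord_recr; by right.
have Ddec (i : nat) : D i.+1 `<=` D i.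
  apply: setDS; rewrite big_ord_recr; exact: subsetUl.
have pDmon : forall i j, (i <= j)%N -> p (D j) <= p (D i).
  move=> i j ij; rewrite -lee_fin -!muE; try exact: GD.
  apply: (@le_measure _ _ _ mu); rewrite ?inE; try exact: GD.
  exact: subset_decreasing Ddec _ _ ij.
under eq_fun do rewrite sumE.
have -> : (fun n => mu (\bigcup_k F k) - mu (D n))%E = (fun n => (p (\bigcup_k F k) - p (D n))%:E).
  by apply/funext => n; rewrite !muE ?EFinB //; exact: GD.
rewrite muE //; apply: cvg_EFin; first by near=> n.
apply/cvgrPdist_le => e e0 /=.
have [n pDn] := pcont GD Ddec D0 e0.
exists n => // m /= nm; rewrite opprB addrCA subrr addr0.
rewrite ger0_norm ?p0 //; last exact: GD.
by apply: (le_trans (pDmon _ _ nm)); exact: ltW.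
Unshelve. all: by end_near. Qed.

HB.instance Definition _ := Content_isMeasure.Build _ X R mu mu_sigma_additive.

(** Retyped over [H], for instance the open sets, so that the extension is literally a Borel
    probability; [HG] is only a propositional equality. *)
Let m (A : set (g_sigma_algebraType H)) : \bar R := measure_extension mu A.

Let m0 : m set0 = 0%E. Proof. exact: mu_ext0. Qed.
Let m_ge0 A : (0 <= m A)%E. Proof. exact: mu_ext_ge0. Qed.
Let m_sigma_additive : semi_sigma_additive m.
Proof.
move=> F mF tF mUF.
apply: (@measure_semi_sigma_additive _ _ _ (measure_extension mu)) => //.
  by move=> i; have := mF i; rewrite /measurable /= HG.
by move: mUF; rewrite /measurable /= HG.
Qed.

HB.instance Definition _ := isMeasure.Build _ _ R m m0 m_ge0 m_sigma_additive.

Let mE A : G A -> m A = (p A)%:E.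
Proof. by move=> GA; rewrite -muE //; exact: measurable_mu_extE. Qed.

Let mT : m setT = 1%E.
Proof. by rewrite mE ?pT // -setC0; case: Galg => G0 _; exact. Qed.

HB.instance Definition _ := Measure_isProbability.Build _ _ R m mT.

(* Measures are functions on all subsets; the extension is an outer measure, hence
   monotone also on non-measurable sets. *)
Lemma algebra_extension : exists P : probability (g_sigma_algebraType H) R,
  (forall A, G A -> P A = (p A)%:E) /\
  (forall A B, A `<=` B -> (P A <= P B)%E).
Proof.
exists m; split; first exact: mE.
by move=> A B AB; exact: le_mu_ext.
Qed.

End algebra_extension.

(** An injection into nat need not be onto: the default [x0] fills the remaining indices, all of
    them if [D] is empty. *)
Lemma countable_enum (T : choiceType) (D : set T) (x0 : T) : countable D ->
  exists u : nat -> T, (forall n, D (u n) \/ u n = x0) /\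
    forall x, D x -> exists n, u n = x.
Proof.
move=> /countable_injP[f finj].
exists (fun n => xget x0 [set x | D x /\ f x = n]); split.
  by move=> n; case: xgetP => [x -> [Dx _]|_]; [left|right].
move=> x Dx; exists (f x); case: xgetP => [y _ [Dy fyx]|/(_ x)/= []//].
by apply: finj; rewrite ?inE.
Qed.

Lemma natSinv_lt (R : realType) (e : R) : 0 < e -> exists n : nat, n.+1%:R^-1 < e.
Proof.
move=> e0; have [N _ /(_ N (leqnn _))] := near_infty_natSinv_lt (PosNum e0).
by move=> h; exists N.
Qed.

Lemma natSinv_le (R : realType) (m n : nat) : (m <= n)%N ->
  n.+1%:R^-1 <= m.+1%:R^-1 :> R.
Proof. by move=> mn; rewrite lef_pV2 ?posrE ?ltr0n // ler_nat. Qed.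

Section probability_facts.
Context d (T : measurableType d) (R : realType) (P : probability T R).
Implicit Types A B : set T.

Lemma probability_fin A : measurable A -> P A \is a fin_num.
Proof. exact: fin_num_measure. Qed.

Lemma le_probability A B : measurable A -> measurable B -> A `<=` B ->
  (P A <= P B)%E.
Proof. by move=> mA mB AB; apply: le_measure; rewrite ?inE. Qed.

Lemma le_fine_probability A B : measurable A -> measurable B -> A `<=` B ->
  fine (P A) <= fine (P B).
Proof.
by move=> mA mB AB; rewrite -lee_fin !fineK ?probability_fin ?le_probability.
Qed.

Lemma fine_probabilityC A : measurable A -> fine (P (~` A)) = 1 - fine (P A).
Proof.
move=> mA; rewrite probability_setC // -[in LHS](fineK (probability_fin mA)).
by rewrite -EFinB.
Qed.

Lemma probability_bigcup_le (F : nat -> set T) (e : R) : 0 <= e ->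
  (forall k, measurable (F k)) ->
  (forall k, (P (F k) <= (e / (2 ^ k.+1)%:R)%:E)%E) ->
  (P (\bigcup_k F k) <= e%:E)%E.
Proof.
move=> e0 mF PF.
apply: (le_trans (generalized_Boole_inequality _ mF _)); first exact: bigcup_measurable.
apply: (@le_trans _ _ (\sum_(i <oo) (0 + (e / (2 ^ i.+1)%:R)%:E)%E)%E).
  by apply: lee_nneseries => // n _ /=; rewrite add0e.
apply: le_trans; first exact: epsilon_trick.
by rewrite eseries0 ?add0e.
Qed.

Lemma probability_small (D : nat -> set T) (e : R) : 0 < e ->
  (forall n, measurable (D n)) -> (forall n, D n.+1 `<=` D n) ->
  \bigcap_n D n = set0 -> exists n, (P (D n) < e%:E)%E.
Proof.
move=> e0 mD Dd D0.
have := @nonincreasing_cvg_mu _ _ _ P D; rewrite D0 measure0.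
have h1 : (P (D 0%N) < +oo)%E by rewrite ltey_eq probability_fin.
have h2 : nonincreasing_seq D.
  by apply/nonincreasing_seqP => n; apply/subsetPset.
move=> /(_ h1 mD measurable0 h2) /fine_cvgP[_ /cvgrPdist_lt /(_ _ e0)] [n _].
move=> /(_ n (leqnn _)) /=; rewrite sub0r normrN => h; exists n.
rewrite -(fineK (probability_fin (mD n))) lte_fin.
exact: le_lt_trans (ler_norm _) h.
Qed.

Lemma probability_gt_bigcup (D : nat -> set T) (e : \bar R) :
  (forall n, measurable (D n)) -> (forall n, D n `<=` D n.+1) ->
  (e < P (\bigcup_n D n))%E -> exists n, (e < P (D n))%E.
Proof.
move=> mD Dd ltP.
have h2 : nondecreasing_seq D.
  by apply/nondecreasing_seqP => n; apply/subsetPset.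
have := @nondecreasing_cvg_mu _ _ _ P _ mD (bigcup_measurable (fun k _ => mD k)) h2.
move=> cv; apply: contrapT => /forallNP nD.
suff : (P (\bigcup_n D n) <= e)%E by rewrite leNgt ltP.
rewrite -(cvg_lim (@ereal_hausdorff R) cv); apply: lime_le.
  by apply/cvg_ex; eexists; exact: cv.
by apply: nearW => n; rewrite /= leNgt; exact/negP.
Qed.

End probability_facts.

(** * Regularity *)

Section regularity.
Context (R : realType) (X : ptopologicalType).

Lemma open_borel (A : set X) : open A -> measurable (A : set (borel X)).
Proof. exact: sub_sigma_algebra. Qed.

Lemma closed_borel (A : set X) : closed A -> measurable (A : set (borel X)).
Proof.
move=> cA; rewrite -[A]setCK; apply: measurableC.
by apply: open_borel; exact: closed_openC.
Qed.

Definition superlevel_sets : set (set X) :=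
  [set A | exists (h : X -> R) (r : R), continuous h /\ A = [set x | r < h x]].

Variable P : probability (borel X) R.

Definition regular_set (B : set X) := forall e : R, 0 < e ->
  exists C V : set X, [/\ closed C, open V, C `<=` B, B `<=` V &
    (P (V `\` C) <= e%:E)%E].

(** Complements exchange the two approximations. In a countable union all the open sets may be
    united, but only finitely many of the closed ones; continuity of [P] bounds what the others
    contribute by [e / 2]. *)
Lemma sigma_algebra_regular_set : sigma_algebra setT regular_set.
Proof.
split.
- move=> e e0; exists set0, set0; split => //.
  + exact: closed0.
  + exact: open0.
  + by rewrite setD0 measure0 lee_fin ltW.
- move=> A rA e e0; have [C [V [cC oO CA AO h]]] := rA _ e0.
  exists (~` V), (~` C); rewrite setTD; split.
  + exact: open_closedC.
  + exact: closed_openC.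
  + exact: subsetC.
  + exact: subsetC.
  + by rewrite setDE setCK setIC -setDE.
- move=> F rF e e0.
  have /choice[C /choice[V CO]] : forall k, exists C V : set X,
      [/\ closed C, open V, C `<=` F k, F k `<=` V &
        (P (V `\` C) <= (e / 2 / (2 ^ k.+1)%:R)%:E)%E].
    by move=> k; apply: rF; rewrite !divr_gt0 // ltr0n expn_gt0.
  have mC k : measurable (C k : set (borel X)).
    by apply: closed_borel; have [] := CO k.
  have mO k : measurable (V k : set (borel X)).
    by apply: open_borel; have [] := CO k.
  pose S n := \big[setU/set0]_(i < n) C i.
  have mS n : measurable (S n : set (borel X)) by exact: bigsetU_measurable.
  pose D n := \bigcup_k C k `\` S n.
  have e20 : 0 < e / 2 by rewrite divr_gt0.
  have [n Dn] : exists n, (P (D n) < (e / 2)%:E)%E.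
    apply: probability_small => //.
    + by move=> n; apply: measurableD => //; exact: bigcup_measurable.
    + by move=> n; apply: setDS; rewrite /S big_ord_recr; exact: subsetUl.
    + rewrite -subset0 => x Dx; have [[k _ Ckx] _] := Dx 0%N I.
      by have [_] := Dx k.+1 I; apply; rewrite /S big_ord_recr; right.
  exists (S n), (\bigcup_k V k); split.
  + rewrite /S; elim/big_ind : _ => [|A B|i _]; [exact: closed0|exact: closedU|].
    by have [] := CO i.
  + by apply: bigcup_open => k _; have [] := CO k.
  + apply: (subset_trans (@bigsetU_bigcup _ C n)); apply: subset_bigcup => k _.
    by have [] := CO k.
  + by apply: subset_bigcup => k _; have [] := CO k.
  + have sub : \bigcup_k V k `\` S n `<=` (\bigcup_k (V k `\` C k)) `|` D n.
      move=> x [[k _ Okx] nS].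
      have [Ckx|nC] := pselect (C k x); first by right; split => //; exists k.
      by left; exists k.
    have m1 : measurable (\bigcup_k (V k `\` C k) : set (borel X)).
      by apply: bigcup_measurable => k _; exact: measurableD.
    have m2 : measurable (D n : set (borel X)).
      by apply: measurableD => //; exact: bigcup_measurable.
    apply: (@le_trans _ _ (P ((\bigcup_k (V k `\` C k)) `|` D n))).
      apply: le_probability => //; last exact: measurableU.
      by apply: measurableD => //; exact: bigcup_measurable.
    apply: (le_trans (measureU2 _ m1 m2)).
    rewrite [e in leRHS]splitr EFinD; apply: leeD; last exact: ltW.
    apply: probability_bigcup_le => //; first exact: ltW.
    + by move=> k; exact: measurableD.
    + by move=> k; have [] := CO k.
Qed.

(** The set {h > r} is open, and it is the increasing union of the closed sets {h >= r +
    1/(n+1)}. *)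
Lemma superlevel_regular_set : superlevel_sets `<=` regular_set.
Proof.
move=> _ [h [r [ch ->]]] e e0.
have oA s : open [set x | s < h x].
  by rewrite (_ : mkset _ = h @^-1` [set y | s < y]) //; apply: open_comp => // x _; exact: ch.
have cA s : closed [set x | s <= h x].
  rewrite (_ : mkset _ = h @^-1` [set y | s <= y]) //.
  by apply: preimage_closed => // x _; exact: ch.
pose C n := [set x | r + n.+1%:R^-1 <= h x].
pose D n := [set x | r < h x] `\` C n.
have [n Dn] : exists n, (P (D n) < e%:E)%E.
  apply: probability_small => //.
  - move=> n; apply: measurableD; first exact: open_borel.
    by apply: closed_borel; exact: cA.
  - move=> n; apply: setDS => x /=; apply: le_trans.
    by rewrite lerD2l natSinv_le.
  - rewrite -subset0 => x Dx; have [rx _] := Dx 0%N I.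
    have [n hn] : exists n : nat, n.+1%:R^-1 < h x - r.
      by apply: natSinv_lt; rewrite subr_gt0.
    have [_] := Dx n I; apply; rewrite /C /=; apply/ltW.
    by rewrite -ltrBrDl.
exists (C n), [set x | r < h x]; split => //.
- exact: cA.
- by move=> x; apply: lt_le_trans; rewrite ltrDl invr_gt0 ltr0n.
- exact: ltW.
Qed.

(* This replaces metrizability, which gives it for Polish spaces; it also holds for
   M^1(X), which is not even T0 since its elements may differ on non-Borel sets. *)
Hypothesis baire : (@open X) `<=` <<s superlevel_sets >>.

Lemma borel_regular_set B : <<s @open X >> B -> regular_set B.
Proof.
apply: smallest_sub; first exact: sigma_algebra_regular_set.
apply: (subset_trans baire); apply: smallest_sub.
  exact: sigma_algebra_regular_set.
exact: superlevel_regular_set.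
Qed.

(* A compact set need not be measurable, so monotonicity has to be assumed. *)
Lemma tight_radon :
  (forall K B : set X, compact K -> <<s @open X >> B -> K `<=` B ->
    (P K <= P B)%E) ->
  (forall e : R, 0 < e -> exists2 Q, compact Q /\ closed Q &
    (P (~` Q) <= e%:E)%E) ->
  radon P.
Proof.
move=> mono tight B mB; apply/eqP; rewrite eq_le; apply/andP; split; last first.
  by apply: ge_ereal_sup => _ [K [cK KB] <-]; exact: mono.
apply/lee_addgt0Pr => e e0.
have e20 : 0 < e / 2 by rewrite divr_gt0.
have [C [V [cC oO CB BO h]]] := borel_regular_set mB e20.
have [Q [kQ cQ] hQ] := tight _ e20.
have mQ := closed_borel cQ; have mC := closed_borel cC; have mO := open_borel oO.
have mQC : measurable (Q `&` C : set (borel X)) by exact: measurableI.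
apply: (@le_trans _ _ (P (Q `&` C) + e%:E)%E); last first.
  rewrite leeD2r //; apply: ereal_sup_ubound; exists (Q `&` C) => //; split.
    exact: compact_closedI.
  by move=> x [_]; exact: CB.
have sub : B `<=` (Q `&` C) `|` (~` Q `|` (V `\` C)).
  move=> x Bx; have [Cx|nC] := pselect (C x); last first.
    by right; right; split => //; exact: BO.
  by have [Qx|nQ] := pselect (Q x); [left|right; left].
have m1 : measurable (~` Q `|` (V `\` C) : set (borel X)).
  by apply: measurableU; [exact: measurableC|exact: measurableD].
apply: (le_trans (le_probability P _ _ sub)) => //; first exact: measurableU.
apply: (le_trans (measureU2 _ _ _)) => //; rewrite leeD2l //.
apply: (le_trans (measureU2 _ _ _)) => //; first exact: measurableC.
  exact: measurableD.
by rewrite [e in leRHS]splitr EFinD leeD.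
Qed.

End regularity.

(** * Polish spaces *)

Section polish.
Context (R : realType) (T : ptopologicalType) (d : T -> T -> R).
Hypotheses (d_ge0 : forall x y, 0 <= d x y)
  (d_eq0 : forall x y, d x y = 0 <-> x = y)
  (d_sym : forall x y, d x y = d y x)
  (d_tri : forall x y z, d x z <= d x y + d y z)
  (d_open : forall A : set T, open A <->
     (forall x, A x -> exists2 e : R, 0 < e & [set y | d x y < e] `<=` A))
  (d_complete : forall u : nat -> T,
     (forall e : R, 0 < e -> exists N : nat, forall m n : nat,
        (N <= m)%N -> (N <= n)%N -> d (u m) (u n) < e) ->
     exists l : T, u @ \oo --> l).

Let dxx x : d x x = 0. Proof. by apply/d_eq0. Qed.

Let open_dball x e : open [set y | d x y < e].
Proof.
apply/d_open => y /= dy; exists (e - d x y); first by rewrite subr_gt0.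
by move=> z /=; rewrite ltrBrDl; apply: le_lt_trans; exact: d_tri.
Qed.

Let nbhs_dball x A : nbhs x A <->
  exists2 e : R, 0 < e & [set y | d x y < e] `<=` A.
Proof.
split=> [|[e e0 eA]].
  rewrite nbhsE => -[B [oB Bx] BA].
  have [e e0 eB] := (d_open B).1 oB _ Bx.
  by exists e => //; exact: subset_trans BA.
rewrite nbhsE; exists [set y | d x y < e] => //; split => //=.
by rewrite dxx.
Qed.

Let closed_dball x e : closed [set y | d x y <= e].
Proof.
rewrite -[mkset _]setCK; apply: open_closedC.
rewrite (_ : ~` _ = [set y | e < d x y]); last first.
  by apply/seteqP; split => y /=; rewrite ltNge => /negP.
apply/d_open => y /= dy; exists (d x y - e); first by rewrite subr_gt0.
move=> z /= yz; have := d_tri x z y; rewrite (d_sym z y).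
by move: yz; lra.
Qed.

Lemma metric_hausdorff : hausdorff_space T.
Proof.
move=> x y xy; apply/d_eq0/eqP; rewrite eq_le d_ge0 andbT leNgt; apply/negP => d0.
have d20 : 0 < d x y / 2 by rewrite divr_gt0.
have nb z : nbhs z [set y' | d z y' < d x y / 2].
  by apply/nbhs_dball; exists (d x y / 2).
have [z [/= xz yz]] := xy _ _ (nb x) (nb y).
have := d_tri x z y; rewrite (d_sym z y); move: xz yz; lra.
Qed.

Lemma metric_cozero (V : set T) : open V -> exists g : T -> R,
  [/\ continuous g, forall x, 0 <= g x <= 1 & V = [set x | 0 < g x]].
Proof.
move=> oV.
(* The element 1 keeps the infimum meaningful when [V] is the whole space. *)
pose S x : set R := [set 1] `|` [set d x y | y in ~` V].
have S0 x : lbound (S x) 0 by move=> _ [->|[y _ <-]].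
have S1 x : S x 1 by left.
have hS x : has_inf (S x) by split; [exists 1|exists 0; exact: S0].
pose g x := inf (S x).
have g0 x : 0 <= g x by apply: lb_le_inf; [exists 1|exact: S0].
have g1 x : g x <= 1 by apply: ge_inf; [case: (hS x)|exact: S1].
have gL x z : g x <= g z + d x z.
  rewrite -lerBlDr; apply: lb_le_inf; first by exists 1.
  move=> _ [->|[y nVy <-]].
    by rewrite lerBlDr; apply: (le_trans (g1 x)); rewrite lerDl.
  rewrite lerBlDr; apply: (@le_trans _ _ (d x y)).
    by apply: ge_inf; [case: (hS x)|right; exists y].
  by rewrite addrC.
exists g; split.
- move=> x; apply/cvgrPdist_lt => e e0; apply/nbhs_dball; exists e => //.
  move=> y /= xy; rewrite ltr_norml.
  have := gL x y; have := gL y x; rewrite (d_sym y x) => h1 h2.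
  by apply/andP; split; move: h1 h2 xy; lra.
- by move=> x; rewrite g0 g1.
- apply/seteqP; split => x /=.
    move=> Vx; have [e e0 eV] := (d_open V).1 oV _ Vx.
    apply: (@lt_le_trans _ _ (Num.min 1 e)); first by rewrite lt_min ltr01.
    apply: lb_le_inf; first by exists 1.
    move=> _ [->|[y nVy <-]]; first by rewrite ge_min lexx.
    by rewrite ge_min; apply/orP; right; rewrite leNgt; apply/negP => /eV.
  move=> gx; apply: contrapT => nVx; move: gx; apply/negP; rewrite -leNgt.
  apply: ge_inf; first by case: (hS x).
  by right; exists x.
Qed.

Hypothesis separable : exists2 D : set T, countable D & closure D = setT.

(** Ulam's theorem. For each k, finitely many closed balls of radius 1/(k+1) carry all but e /
    2^(k+1) of the mass; the intersection over k is closed and totally bounded, hence compact by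
    completeness. *)
Lemma metric_tight (P : probability (borel T) R) (e : R) : 0 < e ->
  exists2 Q : set T, compact Q /\ closed Q & (P (~` Q) <= e%:E)%E.
Proof.
move=> e0; have [D cD clD] := separable.
have [u [_ uD]] := countable_enum point cD.
have cover r x : 0 < r -> exists n, d (u n) x < r.
  move=> r0; have : closure D x by rewrite clD.
  have nb : nbhs x [set y | d x y < r] by apply/nbhs_dball; exists r.
  move=> /(_ _ nb)[y [/uD[n <-]] /=]; rewrite d_sym => h; by exists n.
pose V k n := [set x | exists2 i, (i < n)%N & d (u i) x <= k.+1%:R^-1].
have cV k n : closed (V k n).
  elim: n => [|n IH].
    rewrite (_ : V _ _ = set0); first exact: closed0.
    by rewrite -subset0 => x [].
  rewrite (_ : V _ _ = V k n `|` [set x | d (u n) x <= k.+1%:R^-1]).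
    by apply: closedU; [exact: IH|exact: closed_dball].
  apply/seteqP; split => x.
    move=> [i]; rewrite ltnS leq_eqVlt => /predU1P[->|ik] h; [by right|left].
    by exists i.
  move=> [[i ik h]|h]; first by exists i => //; exact: ltnW.
  by exists n.
have /choice[n nP] : forall k, exists n,
    (P (~` V k n) < (e / (2 ^ k.+1)%:R)%:E)%E.
  move=> k; apply: probability_small.
  - by rewrite divr_gt0 // ltr0n expn_gt0.
  - by move=> n; apply: measurableC; apply: closed_borel; exact: cV.
  - by move=> n; apply: subsetC => x [i ik h]; exists i => //; exact: ltnW.
  - rewrite -subset0 => x h.
    have [i /ltW ix] := cover k.+1%:R^-1 x (ltac:(by rewrite invr_gt0 ltr0n)).
    by apply: (h i.+1 I); exists i.
pose Q := \bigcap_k V k (n k).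
have cQ : closed Q by apply: closed_bigI => k _; exact: cV.
exists Q; last first.
  rewrite setC_bigcap; apply: probability_bigcup_le; first exact: ltW.
    by move=> k; apply: measurableC; apply: closed_borel; exact: cV.
  by move=> k; apply: ltW; exact: nP.
split => //.
rewrite compact_ultra => F UF FQ.
(* An ultrafilter containing a finite union of balls contains one of them. *)
have /choice[i iP] : forall k, exists i, F [set x | d (u i) x <= k.+1%:R^-1].
  move=> k; have : F (V k (n k)).
    by apply: filterS FQ => x Qx; exact: Qx.
  elim: (n k) => [|m IH] FV.
    have [x [j]] : V k 0%N !=set0 by exact: filter_ex FV.
    by [].
  have [FB|FnB] := in_ultra_setVsetC [set x | d (u m) x <= k.+1%:R^-1] UF.
    by exists m.
  apply: IH; apply: filterS (filterI FV FnB) => x [[j jm jx] nx].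
  exists j => //; rewrite ltn_neqAle -ltnS jm andbT.
  by apply/eqP => jm'; apply: nx; rewrite -jm'.
(* [x k] lies in the first k+1 selected balls, so the sequence is Cauchy; its limit is also the
   limit of [F]. *)
have /choice[x xP] : forall k, exists x,
    forall j, (j <= k)%N -> d (u (i j)) x <= j.+1%:R^-1.
  move=> k.
  suff /filter_ex[x xk] : F [set x | forall j, (j <= k)%N ->
      d (u (i j)) x <= j.+1%:R^-1] by exists x.
  elim: k => [|k IH].
    by apply: filterS (iP 0%N) => y h j; rewrite leqn0 => /eqP ->.
  apply: filterS (filterI IH (iP k.+1)) => y [h1 h2] j.
  by rewrite leq_eqVlt => /predU1P[-> //|]; rewrite ltnS => /h1.
have xx N m k : (N <= m)%N -> (N <= k)%N -> d (x m) (x k) <= N.+1%:R^-1 + N.+1%:R^-1.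
  move=> Nm Nk; apply: (le_trans (d_tri _ (u (i N)) _)).
  by apply: lerD; [rewrite d_sym|]; exact: xP.
have [r|l xl] := d_complete (u := x).
  move=> r0; have r20 : 0 < r / 2 by rewrite divr_gt0.
  have [N hN] := natSinv_lt r20; exists N => m k Nm Nk.
  by apply: (le_lt_trans (xx _ _ _ Nm Nk)); rewrite [r]splitr ltrD.
have Fl : F --> l.
  move=> A /nbhs_dball[r r0 rA].
  have r40 : 0 < r / 4 by rewrite divr_gt0.
  have [k hk] := natSinv_lt r40.
  have /xl[N _ NP] : nbhs l [set y | d l y < r / 4] by apply/nbhs_dball; exists (r / 4).
  have := NP (maxn N k) (leq_maxl _ _); rewrite /= => h.
  have := xP (maxn N k) k (leq_maxr _ _) => h2.
  apply: filterS (iP k) => y /= h3; apply: rA => /=.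
  have := d_tri l (x (maxn N k)) y; have := d_tri (x (maxn N k)) (u (i k)) y.
  by rewrite (d_sym _ (u (i k))); move: h h2 h3 hk; move: (k.+1%:R^-1) => q; lra.
exists l; split => //.
by apply: (@closed_cvg _ _ F _ id Q cQ _ l Fl); exact: FQ.
Qed.

End polish.

Section polish_facts.
Context (R : realType) (T : ptopologicalType).
Hypothesis pT : polish R T.

Lemma polish_hausdorff : hausdorff_space T.
Proof.
have [_ [d [d0 deq dst dop dc]]] := pT.
exact: (metric_hausdorff d0 deq (fun x y => (dst x y).1) (fun x y => (dst x y).2)).
Qed.

Lemma polish_cozero (V : set T) : open V -> exists g : T -> R,
  [/\ continuous g, forall x, 0 <= g x <= 1 & V = [set x | 0 < g x]].
Proof.
have [_ [d [d0 deq dst dop dc]]] := pT.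
exact: (metric_cozero d0 deq (fun x y => (dst x y).1) (fun x y => (dst x y).2)).
Qed.

Lemma polish_tight (P : probability (borel T) R) (e : R) : 0 < e ->
  exists2 Q : set T, compact Q /\ closed Q & (P (~` Q) <= e%:E)%E.
Proof.
have [sep [d [d0 deq dst dop dc]]] := pT.
exact: (@metric_tight R T d deq (fun x y => (dst x y).1) (fun x y => (dst x y).2) dop dc sep).
Qed.

Lemma polish_superlevel : @open T `<=` <<s @superlevel_sets R T >>.
Proof.
move=> A oA; have [g [cg _ ->]] := polish_cozero oA.
by apply: sub_sigma_algebra; exists g, 0.
Qed.

Lemma polish_radon (P : probability (borel T) R) : radon P.
Proof.
apply: tight_radon; first exact: polish_superlevel.
- move=> K B cK mB KB; apply: le_probability => //.
  by apply: closed_borel; apply: compact_closed cK; exact: polish_hausdorff.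
- exact: polish_tight.
Qed.

End polish_facts.

Lemma measurable_fun_superlevel d (X : measurableType d) (R : realType)
  (f : X -> R) : (forall r, measurable [set x | r < f x]) ->
  measurable_fun setT f.
Proof.
move=> h mD; apply: (measurability _ (measurable_realfun.RGenOInfty.measurableE R)) => //.
move=> _ [_ [r ->] <-]; rewrite setTI.
rewrite (_ : _ @^-1` _ = [set x | r < f x]); first exact: h.
by apply/seteqP; split => x /=; rewrite in_itv /= andbT.
Qed.

Lemma measurable_superlevel d (X : measurableType d) (R : realType) (f : X -> R)
  (r : R) : measurable_fun setT f -> measurable [set x | r < f x].
Proof.
move=> mf; have := mf measurableT `]r, +oo[%classic (measurable_itv _).
rewrite setTI; congr measurable; apply/seteqP; split => x /=;
  by rewrite in_itv /= andbT.
Qed.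

Lemma open_superlevel (X : topologicalType) (R : realType) (f : X -> R) (r : R) :
  continuous f -> open [set x | r < f x].
Proof.
move=> cf; rewrite (_ : mkset _ = f @^-1` [set y | r < y]) //.
by apply: open_comp => // x _; exact: cf.
Qed.

Lemma continuous_measurable_borel (X : ptopologicalType) (R : realType)
  (f : X -> R) : continuous f -> measurable_fun setT (f : borel X -> R).
Proof.
move=> cf; apply: measurable_fun_superlevel => r.
by apply: open_borel; exact: open_superlevel.
Qed.

(** * The tight topology *)

Section staircase.
Context (R : realType) (n : nat) (s : R).
Hypothesis s01 : 0 <= s <= 1.
Let q : R := n.+1%:R^-1.
Let c k : R := (k%:R * q < s)%R%:R.
(** [m k] is [s] cut off at height k * q. Its increment is [q] while the step stays below [s] and 0
    once the step starts above [s], hence lies between [q * c k.+1] and [q * c k]; these bounds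
    telescope. *)
Let m k : R := Num.min s (k%:R * q).

Let q0 : 0 < q. Proof. by rewrite invr_gt0 ltr0n. Qed.

Let mS k : k.+1%:R * q = k%:R * q + q.
Proof. by rewrite -addn1 natrD mulrDl mul1r. Qed.

Let lo k : q * c k.+1 <= m k.+1 - m k.
Proof.
rewrite /c /m mS !minEle; have := q0; case: (ltP (k%:R * q + q) s) => h;
  case: (leP s (k%:R * q)) => h1; case: (leP s (k%:R * q + q)) => h2; move: h h1 h2;
  rewrite ?mulr1 ?mulr0; lra.
Qed.

Let up k : m k.+1 - m k <= q * c k.
Proof.
rewrite /c /m mS !minEle; have := q0; case: (ltP (k%:R * q) s) => h;
  case: (leP s (k%:R * q)) => h1; case: (leP s (k%:R * q + q)) => h2; move: h h1 h2;
  rewrite ?mulr1 ?mulr0; lra.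
Qed.

Lemma staircase_le : q * (\sum_(k < n.+1) c k.+1) <= s.
Proof.
rewrite mulr_sumr; apply: (@le_trans _ _ (\sum_(k < n.+1) (m k.+1 - m k))).
  by apply: ler_sum => k _; exact: lo.
rewrite -(big_mkord xpredT (fun k => m k.+1 - m k)) telescope_sumr //.
rewrite /m /q mulfV ?pnatr_eq0 // mul0r.
have /andP[s0 s1] := s01.
by rewrite (min_l s1) (min_r s0) subr0.
Qed.

Lemma staircase_ge : s <= q + q * (\sum_(k < n.+1) c k.+1).
Proof.
rewrite -lerBlDl mulr_sumr.
(* Shifted by one step, so that the thresholds are those of the lower bound; the omitted first step
   costs at most [q]. *)
apply: (@le_trans _ _ (\sum_(k < n.+1) (m k.+2 - m k.+1))); last first.
  by apply: ler_sum => k _; exact: up.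
rewrite -(big_mkord xpredT (fun k => m k.+2 - m k.+1)).
rewrite (telescope_sumr (fun k => m k.+1)) // /m mul1r.
have -> : n.+2%:R * q = 1 + q.
  by rewrite mS /q mulfV ?pnatr_eq0.
have /andP[s0 s1] := s01.
rewrite (@min_l _ _ s (1 + q)); last by have := q0; move: s1; lra.
by rewrite minEle; case: (leP s q); have := q0; move: s0 s1; lra.
Qed.

End staircase.

Section mass.
Context (R : realType) (T : ptopologicalType).
Implicit Types (P : M1 R T) (A B : set T).

Definition mass (A : set T) (P : M1 R T) : R := fine (sval P A).

Lemma massE P A : <<s @open T >> A -> sval P A = (mass A P)%:E.
Proof. by move=> mA; rewrite /mass fineK // probability_fin. Qed.

Lemma mass_ge0 P A : 0 <= mass A P. Proof. exact: fine_ge0. Qed.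

Lemma le_mass P A B : <<s @open T >> A -> <<s @open T >> B -> A `<=` B ->
  mass A P <= mass B P.
Proof. exact: (@le_fine_probability _ (borel T) _ (sval P)). Qed.

Lemma massT P : mass setT P = 1.
Proof. by rewrite /mass probability_setT. Qed.

Lemma mass_le1 P A : <<s @open T >> A -> mass A P <= 1.
Proof.
move=> mA; rewrite -(massT P); apply: le_mass => //.
exact: (@measurableT _ (borel T)).
Qed.

Lemma massC P A : <<s @open T >> A -> mass (~` A) P = 1 - mass A P.
Proof. exact: (@fine_probabilityC _ (borel T) _ (sval P)). Qed.

Lemma massU P A B : <<s @open T >> A -> <<s @open T >> B -> A `&` B = set0 ->
  mass (A `|` B) P = mass A P + mass B P.
Proof.
move=> mA mB AB; by rewrite /mass measureU // fineD // probability_fin.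
Qed.

End mass.

Section bounded_continuous_integral.
Context (R : realType) (T : ptopologicalType).
Implicit Types (P : M1 R T) (f : T -> R).

Lemma continuous_bounded_integrable (P : probability (borel T) R) f (M : R) :
  continuous f -> (forall x, `|f x| <= M) -> P.-integrable setT (EFin \o f).
Proof.
move=> cf fM; apply: measurable_bounded_integrable => //.
- by rewrite ltey_eq probability_fin.
- exact: continuous_measurable_borel.
- by exists M; split; rewrite ?num_real // => r Mr x _ /=; apply: le_trans (fM x) (ltW Mr).
Qed.

(** Convertible to [integ] on bounded continuous functions, but also applicable to step
    functions. *)
Definition expect f (P : M1 R T) : R := Rintegral (sval P) setT f.

Lemma expect_scale f (M a b : R) P : continuous f -> (forall x, `|f x| <= M) ->
  expect (fun x => a * f x + b) P = a * expect f P + b.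
Proof.
move=> cf fM; rewrite /expect.
have if_ := continuous_bounded_integrable (sval P) cf fM.
have iaf : (sval P).-integrable setT (EFin \o (fun x => a * f x)).
  have := integrableZl measurableT a if_.
  by apply: eq_integrable => //= x _; rewrite EFinM.
rewrite (@RintegralD _ _ _ (sval P) setT (fun x => a * f x) (cst b)) //.
- rewrite RintegralZl // Rintegral_cst //.
  by rewrite -[fine _]/(mass setT P) massT mulr1.
- exact: finite_measure_integrable_cst.
Qed.

Lemma expect_sum_indic (n : nat) (V : nat -> set T) P :
  (forall k, <<s @open T >> (V k)) ->
  expect (fun x => \sum_(k < n) \1_(V k) x) P = \sum_(k < n) mass (V k) P.
Proof.
move=> mV; rewrite /expect /Rintegral.
rewrite (_ : (fun x => _) = (fun x : borel T =>
    (\sum_(k <- index_enum 'I_n) (\1_(V k) x : R)%:E)%E)); last first.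
  by apply/funext => x; rewrite sumEFin.
rewrite ge0_integral_sum //=.
- rewrite (eq_bigr (fun k : 'I_n => (mass (V k) P)%:E)) ?sumEFin // => k _.
  rewrite integral_indic //.
    by rewrite -(massE P (mV k)); congr (sval P _); exact: setIT.
  exact: mV.
- move=> k; apply/measurable_EFinP; apply: measurable_indic; exact: mV.
Qed.

End bounded_continuous_integral.

Section M1t_topology.
Context (R : realType) (T : ptopologicalType).
Implicit Types (P : M1 R T) (V : set T).

Lemma M1t_cvg (F : set_system (M1 R T)) P : Filter F ->
  (forall f : bcont R T, integ f @ F --> integ f P) -> F --> (P : M1t R T).
Proof.
move=> FF h; apply/cvg_sup => f A /= [_ [[B Bop <-] Bfs sBfA]].
have /h FB : nbhs (integ f P) B by rewrite nbhsE; exists B.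
exact: (filterS sBfA FB).
Qed.

Lemma integ_continuous (f : bcont R T) : continuous (integ f : M1t R T -> R).
Proof.
move=> P; have /cvg_sup/(_ f) h := @cvg_id _ (nbhs (P : M1t R T)).
by move=> A /(@initial_continuous _ _ (integ f)) /h.
Qed.

(* The portmanteau criterion: P' |-> P'(V) is lower semicontinuous at P along F. *)
Definition liminf_open (F : set_system (M1 R T)) P := forall V, open V ->
  forall q : R, q < mass V P -> F [set P' | q < mass V P'].

(** Integrates the staircase bounds. The error 1/(n+1) does not depend on [P], so the expectations
    under two measures can be compared through finitely many open superlevel sets. *)
Lemma expect_ge_step (f : T -> R) (n : nat) P :
  continuous f -> (forall x, 0 <= f x <= 1) ->
  n.+1%:R^-1 * (\sum_(k < n.+1) mass [set x | k.+1%:R * n.+1%:R^-1 < f x] P)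
    <= expect f P <=
  n.+1%:R^-1 + n.+1%:R^-1 *
    (\sum_(k < n.+1) mass [set x | k.+1%:R * n.+1%:R^-1 < f x] P).
Proof.
move=> cf f01; pose V k := [set x | k.+1%:R * n.+1%:R^-1 < f x].
have mV k : <<s @open T >> (V k).
  by apply: sub_sigma_algebra; exact: open_superlevel.
pose s x : R := \sum_(k < n.+1) \1_(V k) x.
have sE x : s x = \sum_(k < n.+1) (k.+1%:R * n.+1%:R^-1 < f x)%R%:R.
  apply: eq_bigr => k _; rewrite indicE; congr (_%:R); congr (nat_of_bool _).
  by apply/idP/idP; rewrite inE.
have ms : measurable_fun setT (s : borel T -> R).
  by apply: measurable_sum => k; apply: measurable_indic; exact: mV.
have is_ a b : (sval P).-integrable setT (EFin \o (fun x => a * s x + b)).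
  apply: measurable_bounded_integrable => //.
  - by rewrite ltey_eq probability_fin.
  - by apply: measurable_funD => //; exact: measurable_funM.
  - exists (`|a| * n.+1%:R + `|b|); split; rewrite ?num_real // => r hr x _ /=.
    apply: le_trans (ltW hr); apply: (le_trans (ler_normD _ _)).
    rewrite lerD2r normrM ler_wpM2l //.
    rewrite ger0_norm; last by apply: sumr_ge0 => k _; rewrite indicE.
    apply: (@le_trans _ _ (\sum_(k < n.+1) 1)).
      by apply: ler_sum => k _; rewrite indicE; case: (_ \in _).
    by rewrite sumr_const card_ord.
have if_ : (sval P).-integrable setT (EFin \o f).
  apply: (@continuous_bounded_integrable _ _ _ _ 1) => // x.
  by have /andP[f0 f1] := f01 x; rewrite ger0_norm.
have Es a b : expect (fun x => a * s x + b) P =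
    a * (\sum_(k < n.+1) mass (V k) P) + b.
  rewrite -(expect_sum_indic n.+1 P mV) /expect.
  have i1 : (sval P).-integrable setT (EFin \o s).
    have := is_ 1 0; apply: eq_integrable => // x _ /=.
    by rewrite mul1r addr0.
  have ia : (sval P).-integrable setT (EFin \o (fun x => a * s x)).
    have := is_ a 0; apply: eq_integrable => // x _ /=.
    by rewrite addr0.
  rewrite (@RintegralD _ _ _ (sval P) setT (fun x => a * s x) (cst b)) //.
    rewrite RintegralZl // Rintegral_cst //.
    by rewrite -[fine _]/(mass setT P) massT mulr1.
  exact: finite_measure_integrable_cst.
apply/andP; split.
- rewrite -[leLHS]addr0 -Es; apply: le_Rintegral => // x _.
  by rewrite addr0 sE staircase_le.
- rewrite addrC -Es; apply: le_Rintegral => // x _.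
  by rewrite addrC sE staircase_ge.
Qed.

(** The discretization costs 1/(n+1) < e/2. Each of the n+1 superlevel sets loses at most e/2 along
    [F], and so does their average. *)
Lemma liminf_expect (F : set_system (M1 R T)) P (f : T -> R) (e : R) : Filter F ->
  liminf_open F P -> continuous f -> (forall x, 0 <= f x <= 1) -> 0 < e ->
  F [set P' | expect f P - e < expect f P'].
Proof.
move=> FF lF cf f01 e0.
have e20 : 0 < e / 2 by rewrite divr_gt0.
have [n hn] := natSinv_lt e20.
pose V k := [set x | k.+1%:R * n.+1%:R^-1 < f x].
have : F [set P' | forall k : 'I_n.+1, mass (V k) P - e / 2 < mass (V k) P'].
  apply: (@filter_forall _ _ (fun (k : 'I_n.+1) P' => mass (V k) P - e / 2 < mass (V k) P')) => k.
  apply: lF; first exact: open_superlevel.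
  by rewrite ltrBlDr ltrDl.
apply: filterS => P' h /=.
pose S P0 := n.+1%:R^-1 * (\sum_(k < n.+1) mass (V k) P0).
have h1 : expect f P <= n.+1%:R^-1 + S P by have /andP[] := expect_ge_step n P cf f01.
have h2 : S P' <= expect f P' by have /andP[] := expect_ge_step n P' cf f01.
have h3 : S P - e / 2 <= S P'.
  apply: (@le_trans _ _ (n.+1%:R^-1 * (\sum_(k < n.+1) (mass (V k) P - e / 2)))).
    rewrite big_split /= mulrDr lerD2l sumr_const card_ord -(mulr_natl (- (e / 2))).
    by rewrite mulrA mulVf ?mul1r // pnatr_eq0.
  rewrite ler_wpM2l ?invr_ge0 ?ler0n //.
  by apply: ler_sum => k _; apply: ltW; exact: h.
move: h1 h2 h3 hn; move: (S P) (S P') (n.+1%:R^-1) => a b q; lra.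
Qed.

(** The lower bound for both f and -f, rescaled into [0, 1], gives two-sided convergence of the
    integrals. *)
Lemma liminf_cvg (F : set_system (M1 R T)) P : Filter F ->
  liminf_open F P -> F --> (P : M1t R T).
Proof.
move=> FF lF; apply: M1t_cvg => -[f [cf [M fM]]].
have M0 : 0 <= M by exact: le_trans (normr_ge0 _) (fM point).
(* [a * f] has values in [-1/2, 1/2], and adding 1/2 moves them into [0, 1]. The summand 1 keeps [N]
   positive when [M] is 0. *)
pose N := M + 1; have N0 : 0 < N by rewrite /N ltr_wpDl.
pose a := (2 * N)^-1.
have a0 : 0 < a by rewrite invr_gt0 mulr_gt0.
have aN : a * N = 1 / 2 by rewrite /a invfM -mulrA mulVf ?gt_eqF // mul1r mulr1.
have lower (b : R) (e : R) : `|b| = a -> 0 < e ->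
    F [set P' | b * expect f P - e < b * expect f P'].
  move=> ba e0.
  have cg : continuous (fun x => b * f x + 1 / 2).
    move=> x; apply: cvgD; last exact: cvg_cst.
    by apply: cvgM; [exact: cvg_cst|exact: cf].
  have g01 x : 0 <= b * f x + 1 / 2 <= 1.
    have : `|b * f x| <= 1 / 2.
      rewrite normrM ba -aN ler_pM2l //; apply: (le_trans (fM x)).
      by rewrite /N lerDl.
    by rewrite ler_norml => /andP[]; lra.
  have := liminf_expect FF lF cg g01 e0; apply: filterS => P' /=.
  rewrite !(expect_scale _ _ _ cf fM); lra.
apply/cvgrPdist_lt => e e0.
have ae0 : 0 < a * e by exact: mulr_gt0.
have := lower _ _ (gtr0_norm a0) ae0.
have := lower (- a) _ _ ae0; rewrite normrN => /(_ (gtr0_norm a0)) h1 h2.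
apply: filterS (filterI h1 h2) => P' [/= h3 h4].
rewrite ltr_norml; apply/andP.
have {}h3 : a * expect f P' < a * (expect f P + e) by rewrite mulrDr; lra.
have {}h4 : a * expect f P < a * (expect f P' + e) by rewrite mulrDr; lra.
rewrite ltr_pM2l // in h3; rewrite ltr_pM2l // in h4.
rewrite -[integ _ P]/(expect f P) -[integ _ P']/(expect f P').
split; lra.
Qed.

End M1t_topology.

Definition open_base (T : topologicalType) (u : nat -> set T) :=
  (forall n, open (u n)) /\
  forall V x, open V -> V x -> exists n, u n x /\ u n `<=` V.

Lemma countable_basis_enum (T : topologicalType) (U : set (set T)) :
  countable U -> basis U -> exists u : nat -> set T, open_base u /\
    forall n, U (u n) \/ u n = set0.
Proof.
move=> cU [Uo Ub]; have [u [uU Uu]] := countable_enum set0 cU.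
exists u; split => //; split.
  by move=> n; case: (uU n) => [/Uo //|->]; exact: open0.
move=> V x oV Vx.
have /Ub[W [UW Wx] WV] : nbhs x V by apply: open_nbhs_nbhs.
by have [n nW] := Uu _ UW; exists n; rewrite nW.
Qed.

Lemma Rintegral_mass (R : realType) (T : ptopologicalType) (P : M1 R T)
  (A : set T) : <<s @open T >> A -> mass A P = Rintegral (sval P) setT (\1_A).
Proof.
move=> mA; rewrite /Rintegral integral_indic //.
by congr (fine (sval P _)); apply/esym; exact: setIT.
Qed.

(** Second countability in filter form: the finite intersections of the [B j] containing x generate
    a filter that converges to x, so an open set is the union of the finite intersections [W t]
    inside it, and there are countably many [t]. *)
Lemma open_countable_subbase (X : ptopologicalType) (J : countType)
  (B : J -> set X) (S : set (set X)) : (forall j, <<s S >> (B j)) ->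
  (forall (F : set_system X) x, Filter F -> (forall j, B j x -> F (B j)) -> F --> x) ->
  @open X `<=` <<s S >>.
Proof.
move=> mB hB A oA.
pose W (t : seq J) : set X := [set x | forall j, j \in t -> B j x].
have mW t : <<s S >> (W t).
  elim: t => [|j t IH].
    rewrite (_ : W _ = setT); last by apply/seteqP; split.
    exact: (@measurableT _ (g_sigma_algebraType S)).
  rewrite (_ : W _ = B j `&` W t).
    by apply: (@measurableI _ (g_sigma_algebraType S)); [exact: mB|exact: IH].
  apply/seteqP; split => x.
    move=> H; split; first by apply: H; rewrite mem_head.
    by move=> k kt; apply: H; rewrite inE kt orbT.
  move=> [h1 h2] k; rewrite inE => /predU1P[->//|]; exact: h2.
have AE : A = \bigcup_(t in [set t | W t `<=` A]) W t.
  apply/seteqP; split => [x Ax|x [t tA /tA//]].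
  pose F := filter_from [set t | W t x] W.
  have FF : Filter F.
    apply: filter_from_filter; first by exists [::].
    move=> s t Ws Wt; exists (s ++ t).
      by move=> j; rewrite mem_cat => /orP[/Ws|/Wt].
    by move=> y h; split => j js; apply: h; rewrite mem_cat js // orbT.
  have Fx : F --> x.
    apply: hB => j Bx; exists [:: j]; first by move=> k; rewrite inE => /eqP ->.
    by move=> y; apply; rewrite mem_head.
  have /Fx[t Wt tA] : nbhs x A by apply: open_nbhs_nbhs.
  by exists t.
rewrite AE bigcup_mkcond.
apply: (@countable_bigcupT_measurable _ (g_sigma_algebraType S)) => [|t].
  exact: countableP.
case: ifP => _; first exact: mW.
exact: (@measurable0 _ (g_sigma_algebraType S)).
Qed.

Section mass_topology.
Context (R : realType) (T : ptopologicalType) (u : nat -> set T).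
Hypotheses (pT : polish R T) (ub : open_base u).
Implicit Types (P : M1 R T) (V : set T).

Definition fin_union (s : seq nat) : set T := \bigcup_(i in [set` s]) u i.

Lemma open_fin_union s : open (fin_union s).
Proof. by apply: bigcup_open => i _; have [] := ub. Qed.

Lemma open_bigcup_fin_union V : open V -> exists s : nat -> seq nat,
  [/\ forall n, fin_union (s n) `<=` V,
      forall n, fin_union (s n) `<=` fin_union (s n.+1)
    & \bigcup_n fin_union (s n) = V].
Proof.
move=> oV.
pose s n := [seq i <- iota 0 n | `[< u i `<=` V >]].
have sV n : fin_union (s n) `<=` V.
  by move=> x [i /=]; rewrite mem_filter => /andP[/asboolP uV _] /uV.
exists s; split => //.
  move=> n x [i /=]; rewrite mem_filter mem_iota => /andP[h1 /andP[_ h2]] ux.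
  exists i => //=; rewrite mem_filter h1 mem_iota /= add0n ltnW //.
apply/seteqP; split => [x [n _ /sV]//|x Vx].
have [_ /(_ _ _ oV Vx)[n [ux uV]]] := ub.
exists n.+1 => //; exists n => //=.
by rewrite mem_filter mem_iota /= add0n leqnn andbT; exact/asboolP.
Qed.

Lemma mass_gt_fin_union V P (q : R) : open V -> q < mass V P ->
  exists2 s, fin_union s `<=` V & q < mass (fin_union s) P.
Proof.
move=> oV qV; have [s [sV sS VE]] := open_bigcup_fin_union oV.
have ms n : measurable (fin_union (s n) : set (borel T)).
  by apply: open_borel; exact: open_fin_union.
have : (q%:E < sval P (\bigcup_n fin_union (s n)))%E.
  by rewrite VE massE ?lte_fin //; exact: open_borel.
move=> /(probability_gt_bigcup ms sS)[n]; rewrite massE; last exact: ms.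
by rewrite lte_fin => h; exists (s n).
Qed.

(** Continuity from below exhausts an open set by finite unions of basic sets, so only countably
    many sets need testing. *)
Lemma liminf_open_base (F : set_system (M1 R T)) P : Filter F ->
  (forall s (q : R), q < mass (fin_union s) P ->
     F [set P' | q < mass (fin_union s) P']) ->
  liminf_open F P.
Proof.
move=> FF h V oV q /(mass_gt_fin_union oV)[s sV /h]; apply: filterS => P' /=.
move=> /lt_le_trans; apply; apply: le_mass => //.
- by apply: open_borel; exact: open_fin_union.
- exact: open_borel.
Qed.

(* If V = {g > 0}, then P(V) is the supremum of the integrals of min(1, (n+1) g). *)
Lemma mass_gt_superlevel V (q : R) : open V ->
  exists F : nat -> M1t R T -> R, (forall n, continuous (F n)) /\
    [set P : M1t R T | q < mass V P] = \bigcup_n [set P | q < F n P].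
Proof.
move=> oV; have [g [cg g01 VE]] := polish_cozero pT oV.
pose f n x : R := Num.min 1 (n.+1%:R * g x).
have f0 n x : 0 <= f n x.
  have /andP[g0 _] := g01 x.
  by rewrite /f le_min ler01 /= mulr_ge0 // ler0n.
have f1 n x : f n x <= 1 by rewrite /f ge_min lexx.
have cf n : continuous (f n).
  move=> x; apply: (@continuous_min _ _ (cst 1) (fun x => n.+1%:R * g x)).
    exact: cvg_cst.
  by apply: cvgM; [exact: cvg_cst|exact: cg].
have bf n x : `|f n x| <= 1 by rewrite ger0_norm.
pose b n : bcont R T := exist _ (f n) (conj (cf n) (ex_intro _ 1 (bf n))).
exists (fun n => integ (b n) : M1t R T -> R).
split; first by move=> n; exact: integ_continuous.
pose W n := [set x | n.+1%:R^-1 < g x].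
have oW n : open (W n) by exact: open_superlevel.
have mW n : measurable (W n : set (borel T)) by exact: open_borel.
have mV : measurable (V : set (borel T)) by exact: open_borel.
have E1 (P : M1 R T) n : mass (W n) P <= integ (b n) P.
  rewrite -[integ _ _]/(Rintegral (sval P) setT (f n)).
  rewrite (Rintegral_mass P (mW n)).
  apply: le_Rintegral => //.
  - exact: integrable_indic.
  - exact: (continuous_bounded_integrable (sval P) (cf n) (bf n)).
  - move=> x _; rewrite /indic; case: (boolP (x \in W n)) => [/set_mem|_]; last exact: f0.
    rewrite /W /f /= le_min lexx /= => h.
    by rewrite -ler_pdivrMl ?ltr0n // mulr1 ltW.
have E2 (P : M1 R T) n : integ (b n) P <= mass V P.
  rewrite -[integ _ _]/(Rintegral (sval P) setT (f n)).
  rewrite (Rintegral_mass P mV).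
  apply: le_Rintegral => //.
  - exact: (continuous_bounded_integrable (sval P) (cf n) (bf n)).
  - exact: integrable_indic.
  - move=> x _; rewrite /indic; case: (boolP (x \in V)) => [_|/negP nV]; first exact: f1.
    rewrite /f ge_min; apply/orP; right.
    apply: (@le_trans _ _ 0) => //; apply: mulr_ge0_le0; rewrite ?ler0n //.
    rewrite leNgt; apply/negP => gx.
    by apply: nV; rewrite inE VE.
apply/seteqP; split => P /=.
  move=> qV.
  have VU : V = \bigcup_n W n.
    rewrite {1}VE; apply/seteqP; split => x.
      by move=> /natSinv_lt[n hn]; exists n.
    by move=> [n _]; apply: lt_trans; rewrite invr_gt0.
  have WS n : W n `<=` W n.+1.
    by move=> x; apply: le_lt_trans; rewrite natSinv_le.
  have : (q%:E < sval (P : M1 R T) (\bigcup_n W n))%E.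
    by rewrite -VU massE.
  move=> /(probability_gt_bigcup mW WS)[n]; rewrite massE; last exact: mW.
  by rewrite lte_fin => h; exists n => //=; exact: lt_le_trans (E1 _ _).
by move=> [n _ /= /lt_le_trans]; apply; exact: E2.
Qed.

Lemma open_mass_gt V (q : R) : open V -> open [set P : M1t R T | q < mass V P].
Proof.
move=> oV; have [F [cF ->]] := mass_gt_superlevel q oV.
by apply: bigcup_open => n _; exact: open_superlevel.
Qed.

Lemma superlevel_mass_gt V (q : R) : open V ->
  <<s @superlevel_sets R (M1t R T) >> [set P : M1t R T | q < mass V P].
Proof.
move=> oV; have [F [cF ->]] := mass_gt_superlevel q oV.
apply: sigma_algebra_bigcup => n; apply: sub_sigma_algebra.
by exists (F n), q.
Qed.

(** The sets {P(W) > r}, with [W] a finite union of basic sets and r rational, form a countable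
    subbase of the tight topology. *)
Lemma open_M1t_sigma (S : set (set (M1t R T))) :
  (forall V q, open V -> <<s S >> [set P : M1t R T | q < mass V P]) ->
  @open (M1t R T) `<=` <<s S >>.
Proof.
move=> hS; apply: (@open_countable_subbase (M1t R T) _ (fun p : seq nat * rat =>
  [set P : M1t R T | ratr p.2 < mass (fin_union p.1) P])).
  by move=> p; apply: hS; exact: open_fin_union.
move=> F P FF FB; apply: liminf_cvg; apply: liminf_open_base => s q qs.
have [r] := rat_in_itvoo qs; rewrite in_itv /= => /andP[qr rs].
by apply: filterS (FB (s, r) rs) => P' /=; exact: lt_trans.
Qed.

Lemma superlevel_M1t : @open (M1t R T) `<=` <<s @superlevel_sets R (M1t R T) >>.
Proof. by apply: open_M1t_sigma => V q; exact: superlevel_mass_gt. Qed.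

(** The sets of measurable mass form a Dynkin system. [S] and [G] are left open: the lemma serves
    both the tight Borel sets with [G] the open sets, and the cylinders with [G] the algebra of the
    chain. *)
Lemma measurable_mass_sigma (S : set (set (M1t R T))) (G : set (set T)) :
  setI_closed G -> <<s G >> = <<s @open T >> ->
  (forall A (r : R), G A -> <<s S >> [set P : M1t R T | r < mass A P]) ->
  forall A, <<s @open T >> A ->
    measurable_fun setT (mass A : g_sigma_algebraType S -> R).
Proof.
move=> GI GE hS; rewrite -GE.
have mG (A : set (borel T)) : <<s G >> A -> measurable A by rewrite GE.
apply: (@dynkin_induction _ (borel T)); first by rewrite /measurable /= GE.
- exact: GI.
- rewrite (_ : mass _ = cst 1); first exact: measurable_cst.
  by apply/funext => P; exact: massT.
- by move=> A GA; apply: measurable_fun_superlevel => r; exact: hS.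
- move=> A mA mm.
  rewrite (_ : mass _ = (fun P => 1 - mass A P)).
    by apply: measurable_funB => //; exact: measurable_cst.
  by apply/funext => P; exact: massC.
- move=> F mF tF mm; apply/measurable_EFinP.
  rewrite (_ : EFin \o _ = (fun P : g_sigma_algebraType S =>
      \sum_(k <oo | k \in xpredT) (mass (F k) P)%:E)%E).
    apply: ge0_emeasurable_sum => k.
      by move=> P _ _; rewrite lee_fin mass_ge0.
    by move=> _; apply/measurable_EFinP; exact: mm.
  apply/funext => P /=; rewrite -massE; last first.
    by apply: (@bigcup_measurable _ (borel T)) => k _; exact: mF.
  rewrite measure_bigcup //; apply: congr_lim; apply/funext => n.
  apply: eq_big => k; first by rewrite in_setT.
  by move=> _; exact: (massE P (mF k)).
Qed.

Lemma measurable_mass A : <<s @open T >> A ->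
  measurable_fun setT (mass A : borel (M1t R T) -> R).
Proof.
apply: (@measurable_mass_sigma (@open (M1t R T)) (@open T)) => //.
  by move=> B C; exact: openI.
by move=> B r oB; apply: sub_sigma_algebra; exact: open_mass_gt.
Qed.

Lemma measurable_mass_lt A (r : R) : <<s @open T >> A ->
  <<s @open (M1t R T) >> [set P : M1t R T | mass A P < r].
Proof.
move=> mA; rewrite (_ : mkset _ = [set P : M1t R T | - r < - mass A P]).
  apply: (measurable_superlevel (- r) (X := borel (M1t R T))).
  exact: measurableT_comp (measurable_mass mA).
by apply/seteqP; split => P /=; rewrite ltrN2.
Qed.

End mass_topology.

(** * Ultrafilters and compactness *)

Lemma fmap_ultra (S X : Type) (f : S -> X) (F : set_system S) :
  UltraFilter F -> UltraFilter (f @ F).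
Proof.
move=> UF; split; first exact: fmap_proper_filter.
move=> G GF sFG; apply/seteqP; split => // A GA.
have [//|FnA] := in_ultra_setVsetC (f @^-1` A) UF.
have GnA : G (~` A) by exact: sFG.
by have [x []] := filter_ex (filterI GA GnA).
Qed.

Lemma ultra_bounded_cvg (R : realType) (S : Type) (f : S -> R) (a b : R)
  (F : set_system S) : UltraFilter F -> (forall x, a <= f x <= b) ->
  cvg (f @ F).
Proof.
move=> UF fab; have := @segment_compact R a b.
rewrite compact_ultra => /(_ (f @ F) (fmap_ultra f UF)) h.
have [|l [_ fl]] := h; last by apply/cvg_ex; exists l.
by apply: nearW => x /=; rewrite in_itv /=; exact: fab.
Qed.

Lemma compact_decreasing_empty (X : topologicalType) (K : set X) (A : nat -> set X) :
  compact K -> (forall n, closed (A n)) -> (forall n, A n.+1 `<=` A n) ->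
  (\bigcap_n A n) `&` K = set0 -> exists n, A n `&` K = set0.
Proof.
move=> cK cA dA A0; apply: contrapT => /forallNP nA.
pose F := filter_from setT (fun n => A n `&` K).
have dA' := subset_decreasing dA.
have FF : ProperFilter F.
  apply: filter_from_proper; last first.
    by move=> n _; apply/set0P/eqP; exact: nA.
  apply: filter_from_filter; first by exists 0%N.
  move=> m n _ _; exists (maxn m n) => // x [Ax Kx].
  by split; split => //; apply: dA' Ax; rewrite ?leq_maxl ?leq_maxr.
have FK : F K by exists 0%N => // x [].
have [x [Kx Fx]] := cK _ FF FK.
suff : (\bigcap_n A n `&` K) x by rewrite A0.
split => // n _; apply: cA => B nB; apply: Fx => //.
by exists n => // y [].
Qed.

(** * The zero-dimensional refinement *)

Section hat.
Context (T : choiceType) (U : set (set T)).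

Lemma hat_subbase_open V : hat_subbase U V -> @open (hatX U) V.
Proof.
move=> UV; exists [set V]; last by rewrite bigcup_set1.
move=> _ ->; exists [fset V]%fset.
  by move=> W; rewrite inE inE => /eqP ->.
apply/seteqP; split => x /=; first by apply; rewrite /= inE.
by move=> Vx W /=; rewrite inE => /eqP ->.
Qed.

Lemma hat_cvg (F : set_system T) (x : T) : Filter F ->
  (forall V, hat_subbase U V -> V x -> F V) -> F --> (x : hatX U).
Proof.
move=> FF h A /=; rewrite (@nbhsE (hatX U)).
move=> [_ [[B sB <-] [C BC Cx] sUBA]].
apply: filterS sUBA _; apply: (@filterS _ _ _ C); first by move=> ? ?; exists C.
have /sB [D sD IDeC] := BC; rewrite -IDeC; apply: filter_bigI => E DE.
have /sD := DE; rewrite inE => UE; apply: h => //.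
by move: Cx; rewrite -IDeC => /(_ _ DE).
Qed.

Definition hat_clopen (A : set T) := @closed (hatX U) A /\ @closed (hatX U) (~` A).

Lemma hat_clopen_algebra : set_algebra hat_clopen.
Proof.
split.
- by split; [exact: closed0|rewrite setC0; exact: closedT].
- move=> A B [cA cA'] [cB cB']; split; first exact: closedU.
  by rewrite setCU; exact: closedI.
- by move=> A [cA cA']; split => //; rewrite setCK.
Qed.

Lemma hat_clopen_basic V : U V -> hat_clopen V.
Proof.
move=> UV; split.
  rewrite -[V]setCK; apply: open_closedC; apply: hat_subbase_open.
  by right; exists V.
by apply: open_closedC; apply: hat_subbase_open; left.
Qed.

End hat.

Lemma set_algebraI (T : Type) (G : set (set T)) : set_algebra G -> setI_closed G.
Proof.
move=> [_ GU GC] A B GA GB.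
rewrite -[A]setCK -[B]setCK -setCU.
by apply: (GC); apply: (GU); apply: (GC).
Qed.

Lemma set_algebra_setI (T : Type) (G H : set (set T)) :
  set_algebra G -> set_algebra H -> set_algebra (G `&` H).
Proof.
move=> [G0 GU GC] [H0 HU HC]; split => //.
- by move=> A B [GA HA] [GB HB]; split; [exact: GU|exact: HU].
- by move=> A [GA HA]; split; [exact: GC|exact: HC].
Qed.

Lemma set_algebra_sigma (T : pointedType) (G : set (set T)) : set_algebra <<s G >>.
Proof.
split.
- exact: (@measurable0 _ (g_sigma_algebraType G)).
- exact: (@measurableU _ (g_sigma_algebraType G)).
- exact: (@measurableC _ (g_sigma_algebraType G)).
Qed.

(** * Limits of measures along ultrafilters *)

Section ultra_limit.
Context (R : realType) (T : ptopologicalType) (U G : set (set T)).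
Hypotheses (pT : polish R T) (Galg : set_algebra G).
Hypotheses (Ghat : forall A, G A -> @closed (hatX U) A).
Hypothesis GE : <<s G >> = <<s @open T >>.
Variable F : set_system (M1 R T).
Hypothesis UF : UltraFilter F.
Hypothesis tight : forall delta : R, 0 < delta -> exists K : set (hatX U),
  compact K /\ forall A, G A -> A `&` K = set0 -> F [set P | mass A P <= delta].

(* Pointwise limits of the masses are finitely additive on G. If sets of G decrease
   to the empty set, they eventually miss the hat-compact K, hence the limit is
   countably additive. *)
Lemma ultra_limit : exists P : M1 R T, forall A, G A ->
  mass A @ F --> mass A P.
Proof.
have FF : ProperFilter F := @ultra_proper _ _ UF.
have [G0 GU GC] := Galg.
have GT : G setT by rewrite -setC0; exact: GC.
have mG A : G A -> <<s @open T >> A by move=> GA; rewrite -GE; exact: sub_sigma_algebra.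
pose p A : R := lim (mass A @ F).
have pP A : G A -> mass A @ F --> p A.
  move=> GA; apply: (@ultra_bounded_cvg R _ (mass A) 0 1 F UF) => P.
  by rewrite mass_ge0 mass_le1 //; exact: mG.
have [||||| Q [QE _]] := @algebra_extension R T G (@open T) p Galg _ _ _ _ _.
- by rewrite GE.
- move=> A GA; apply: limr_ge; first by apply/cvg_ex; exists (p A); exact: pP.
  by apply: nearW => P; exact: mass_ge0.
- rewrite /p (_ : mass setT = cst 1); first exact: lim_cst.
  by apply/funext => P; exact: massT.
- move=> A B GA GB AB.
  apply: (@cvg_unique _ (@Rhausdorff R) (mass (A `|` B) @ F)).
    exact: pP (GU _ _ GA GB).
  rewrite (_ : mass (A `|` B) = mass A \+ mass B).
    by apply: cvgD; exact: pP.
  by apply/funext => P; rewrite massU //; exact: mG.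
- move=> A GA dA A0 e e0.
  have e20 : 0 < e / 2 by rewrite divr_gt0.
  have [K [cK hK]] := tight e20.
  have [n nK] : exists n, A n `&` K = set0.
    apply: (@compact_decreasing_empty (hatX U)) => //.
      by move=> n; exact: Ghat.
    by rewrite A0 set0I.
  exists n; apply: (@le_lt_trans _ _ (e / 2)); last first.
    by rewrite ltr_pdivrMr // ltr_pMr // ltr1n.
  apply: limr_le; first by apply/cvg_ex; exists (p (A n)); exact: pP.
  exact: hK.
exists (exist _ Q (polish_radon pT Q)) => A GA.
rewrite (_ : mass A _ = p A); first exact: pP.
by rewrite /mass /= QE.
Qed.

End ultra_limit.

(** Rational half-lines, pulled back by countably many functions that determine convergence, form a
    countable subbase; the boolean in [B] selects the side. *)
Lemma open_initial_sigma (R : realType) (X : ptopologicalType) (I : countType)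
  (h : I -> X -> R) (S : set (set X)) :
  (forall (F : set_system X) x, Filter F -> (forall i, h i @ F --> h i x) -> F --> x) ->
  (forall i r, <<s S >> [set x | r < h i x]) ->
  (forall i r, <<s S >> [set x | h i x < r]) ->
  @open X `<=` <<s S >>.
Proof.
move=> hF hS hS'.
pose B (p : I * rat * bool) : set X :=
  if p.2 then [set x | ratr p.1.2 < h p.1.1 x] else [set x | h p.1.1 x < ratr p.1.2].
apply: (@open_countable_subbase _ _ B); first by move=> p; rewrite /B; case: ifP.
move=> F x FF FB; apply: hF => i; apply/cvgrPdist_lt => e e0.
have e1 : h i x - e < h i x by rewrite ltrBlDr ltrDl.
have e2 : h i x < h i x + e by rewrite ltrDl.
have [r] := rat_in_itvoo e1; rewrite in_itv /= => /andP[r1 r2].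
have [t] := rat_in_itvoo e2; rewrite in_itv /= => /andP[t1 t2].
apply: filterS (filterI (FB (i, r, true) r2) (FB (i, t, false) t1)) => y [].
rewrite /B /= => y1 y2; rewrite ltr_norml /=; apply/andP.
by split; move: r1 r2 t1 t2 y1 y2; lra.
Qed.

(** * Partitions and simplices *)

Section Rvec_facts.
Context (R : realType).

Lemma Rvec_cvg (I : Type) (F : set_system (Rvec R I)) (x : Rvec R I) :
  Filter F -> (forall i, (fun p : Rvec R I => p i) @ F --> x i) -> F --> x.
Proof.
move=> FF h; apply/cvg_sup => i A /= [_ [[B Bop <-] Bfs sBfA]].
have /h FB : nbhs (x i) B by rewrite nbhsE; exists B.
exact: (filterS sBfA FB).
Qed.

Lemma Rvec_coord_continuous (I : Type) (i : I) :
  continuous (fun p : Rvec R I => p i).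
Proof.
move=> p; have /cvg_sup/(_ i) h := @cvg_id _ (nbhs p).
by move=> A /(@initial_continuous _ _ (fun p : I -> R => p i)) /h.
Qed.

Lemma Rvec_sum_continuous (I : finType) (Q : pred I) :
  continuous (fun p : Rvec R I => \sum_(i | Q i) p i).
Proof.
apply: (@continuous_big R I +%R 0 Q _ (Rvec R I) _ (fun i p => p i)).
  exact: add_continuous.
by move=> i _; exact: Rvec_coord_continuous.
Qed.

Lemma Rvec_sum_lt_open (I : finType) (Q : pred I) (r : R) :
  open [set p : Rvec R I | \sum_(i | Q i) p i < r].
Proof.
rewrite (_ : mkset _ = (fun p : Rvec R I => \sum_(i | Q i) p i) @^-1` [set y | y < r]) //.
by apply: open_comp => // p _; exact: Rvec_sum_continuous.
Qed.

Lemma open_Rvec_sigma (I : finType) (S : set (set (Rvec R I))) :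
  (forall i r, <<s S >> [set p | r < p i]) ->
  (forall i r, <<s S >> [set p | p i < r]) ->
  @open (Rvec R I) `<=` <<s S >>.
Proof.
move=> h1 h2; apply: (@open_initial_sigma R (Rvec R I) I (fun i p => p i)) => //.
by move=> F x FF; exact: Rvec_cvg.
Qed.

(** Makes [borel_regular_set] applicable to the given measures on the simplices. *)
Lemma superlevel_Rvec (I : finType) :
  @open (Rvec R I) `<=` <<s @superlevel_sets R (Rvec R I) >>.
Proof.
apply: open_Rvec_sigma => i r; apply: sub_sigma_algebra.
  by exists (fun p => p i), r; split => //; exact: Rvec_coord_continuous.
exists (fun p => - p i), (- r); split.
  move=> p; apply: (@continuous_comp _ _ _ (fun p : Rvec R I => p i) (@GRing.opp R)).
    exact: Rvec_coord_continuous.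
  exact: opp_continuous.
by apply/seteqP; split => p /=; rewrite ltrN2.
Qed.

End Rvec_facts.

Lemma preimage_sigma (X Y : Type) (f : X -> Y) (S : set (set X)) (S' : set (set Y)) :
  (forall A, S' A -> <<s S >> (f @^-1` A)) ->
  forall A, <<s S' >> A -> <<s S >> (f @^-1` A).
Proof.
move=> h; apply: (smallest_sub (G := S')) => //; split.
- by rewrite /= preimage_set0; exact: sigma_algebra0.
- move=> A /= mA; rewrite setTD preimage_setC.
  by rewrite -setTD; exact: sigma_algebraCD.
- by move=> A mA /=; rewrite preimage_bigcup; exact: sigma_algebra_bigcup.
Qed.

Section partitions.
Context (R : realType) (T : ptopologicalType).
Implicit Types (a c : {fset (set T)}) (D : set T).

Lemma partition_cover a x : is_partition a -> exists B : a, fsval B x.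
Proof.
case=> _ _ _ aT; have [B _ Bx] : (\bigcup_(A in [set: a]) fsval A) x by rewrite aT.
by exists B.
Qed.

Lemma partition_uniq a x (A B : a) : is_partition a ->
  fsval A x -> fsval B x -> A = B.
Proof.
move=> [_ _ aI _] Ax Bx; apply/eqP; apply: contrapT => /negP AB.
by have : (fsval A `&` fsval B) x by []; rewrite aI.
Qed.

(** For a partition these are the unions of pieces ([saturatedE]). The dichotomy passes to
    complements and refinements directly. *)
Definition saturated a D := forall B : a, fsval B `<=` D \/ fsval B `&` D = set0.

Lemma saturated_algebra a : set_algebra (saturated a).
Proof.
split.
- by move=> B; right; rewrite setI0.
- move=> D E sD sE B; have [BD|BD] := sD B; first by left; move=> x /BD; left.
  have [BE|BE] := sE B; first by left; move=> x /BE; right.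
  by right; rewrite setIUr BD BE setU0.
- move=> D sD B; have [BD|BD] := sD B; [right|left].
    by rewrite -subset0 => x [/BD].
  by move=> x Bx Dx; have : (fsval B `&` D) x by []; rewrite BD.
Qed.

Lemma saturated_piece a (A : a) : is_partition a -> saturated a (fsval A).
Proof.
move=> pa B; have [->|AB] := eqVneq B A; first by left.
by right; case: pa => _ _ aI _; exact: aI.
Qed.

Lemma saturated_refines a c D : refines a c -> saturated a D -> saturated c D.
Proof.
move=> ac sD B; have [A BA] := ac B; have [AD|AD] := sD A; [left|right].
  exact: subset_trans AD.
by rewrite -subset0 => x [/BA Ax Dx]; rewrite -AD.
Qed.

Lemma saturatedE a D : is_partition a -> saturated a D ->
  D = \big[setU/set0]_(B : a | `[< fsval B `<=` D >]) fsval B.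
Proof.
move=> pa sD; apply/seteqP; split => x.
  move=> Dx; have [B Bx] := partition_cover x pa.
  rewrite -bigcup_seq_cond; exists B => //=; rewrite mem_index_enum /=.
  apply/asboolP; have [//|BD] := sD B.
  by have : (fsval B `&` D) x by []; rewrite BD.
by rewrite -bigcup_seq_cond => -[B /= /andP[_ /asboolP BD] /BD].
Qed.

Lemma mass_big a (Q : pred a) (P : M1 R T) : is_partition a ->
  mass (\big[setU/set0]_(B : a | Q B) fsval B) P =
  \sum_(B : a | Q B) mass (fsval B) P.
Proof.
move=> pa; case: (pa) => _ am aI _.
elim: (index_enum _) (index_enum_uniq a) => [|B s IH] /=.
  by move=> _; rewrite !big_nil /mass measure0.
move=> /andP[Bs us]; rewrite !big_cons; case: ifP => QB; last exact: IH.
rewrite massU //; first by rewrite IH.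
- by apply: (@bigsetU_measurable _ (borel T)) => C _; exact: am.
- rewrite -subset0 => x [Bx]; rewrite -bigcup_seq_cond => -[C /= /andP[Cs _] Cx].
  by move: Bs; rewrite (partition_uniq pa Bx Cx) Cs.
Qed.

Lemma saturated_mass a D (P : M1 R T) : is_partition a -> saturated a D ->
  mass D P = \sum_(B : a | `[< fsval B `<=` D >]) vecof a (P : M1t R T) B.
Proof. by move=> pa sD; rewrite {1}(saturatedE pa sD) mass_big. Qed.

Lemma saturated_borel a D : is_partition a -> saturated a D -> <<s @open T >> D.
Proof.
move=> pa sD; rewrite (saturatedE pa sD).
by apply: (@bigsetU_measurable _ (borel T)) => C _; have [_ am _ _] := pa; exact: am.
Qed.

Lemma refines_trans a c e : refines a c -> refines c e -> refines a e.
Proof.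
by move=> ac ce B; have [C BC] := ce B; have [A CA] := ac C; exists A; exact: subset_trans CA.
Qed.

Lemma phi_vecof a c (P : M1t R T) : is_partition a -> is_partition c ->
  refines a c -> phi a c (vecof c P) = vecof a P.
Proof.
move=> pa pc ac; apply/funext => A; rewrite /phi -saturated_mass //.
by apply: saturated_refines ac _; exact: saturated_piece.
Qed.

Lemma phi_continuous a c : continuous (@phi R T a c).
Proof.
move=> q; apply: Rvec_cvg => [|A]; first by apply: fmap_filter; exact: nbhs_filter.
exact: (@Rvec_sum_continuous R c (fun B => `[< fsval B `<=` fsval A >]) q).
Qed.

Lemma phi_measurable a c (S : set (Rvec R a)) : <<s @open (Rvec R a) >> S ->
  <<s @open (Rvec R c) >> [set q | S (phi a c q)].
Proof.
apply: (@preimage_sigma _ _ (phi a c)) => A oA; apply: sub_sigma_algebra.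
by apply: open_comp => // q _; exact: phi_continuous.
Qed.

Lemma simplex_closed a : closed (@simplex R T a).
Proof.
rewrite (_ : simplex a = (\bigcap_(A in [set: a]) [set p : Rvec R a | 0 <= p A]) `&`
    [set p : Rvec R a | \sum_(A : a) p A = 1]).
  apply: closedI.
    apply: closed_bigI => A _.
    rewrite (_ : mkset _ = (fun p : Rvec R a => p A) @^-1` [set y | 0 <= y]) //.
    by apply: preimage_closed => // x _; exact: Rvec_coord_continuous.
  rewrite (_ : mkset _ = (fun p : Rvec R a => \sum_(A : a) p A) @^-1` [set 1]) //.
  apply: preimage_closed; first by move=> x _; exact: Rvec_sum_continuous.
  exact: closed_eq.
apply/seteqP; split => p /= [h1 h2]; split => // A; first by move=> _; exact: h1.
exact: (h1 A I).
Qed.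

Lemma vecof_simplex a (P : M1t R T) : is_partition a -> simplex a (vecof a P).
Proof.
move=> pa; split; first by move=> A; exact: mass_ge0.
have sT : saturated a setT by move=> B; left.
rewrite -[RHS](massT (P : M1 R T)) (saturated_mass _ pa sT); apply: eq_bigl => B.
by apply/esym/asboolP.
Qed.

(* Put mass p(A) at a point chosen in each piece A. *)
Lemma vecof_surj a (p : Rvec R a) : polish R T -> is_partition a ->
  simplex a p -> exists P : M1t R T, vecof a P = p.
Proof.
move=> pT pa [p0 p1]; case: (pa) => ane am aI _.
have /choice[x xA] : forall A : a, exists x, fsval A x by move=> A; exact: ane.
pose w (E : set T) : R := \sum_(A : a) p A * \1_E (x A).
have [|||||| Q [QE _]] := @algebra_extension R T <<s @open T >> (@open T) w _ _ _ _ _ _.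
- exact: set_algebra_sigma.
- by apply/esym/sigma_algebra_id; exact: smallest_sigma_algebra.
- by move=> E _; apply: sumr_ge0 => A _; apply: mulr_ge0; rewrite // indicE ler0n.
- rewrite /w -[RHS]p1; apply: eq_bigr => A _.
  by rewrite indicT mulr1.
- move=> E F _ _ EF; rewrite /w -big_split /=; apply: eq_bigr => A _.
  rewrite -mulrDr; congr (_ * _); rewrite !indicE in_setU.
  have : ~ (E `&` F) (x A) by rewrite EF.
  case: (boolP (x A \in E)) => [/set_mem Ex|_]; last by rewrite add0r.
  case: (boolP (x A \in F)) => [/set_mem Fx|_]; last by rewrite addr0.
  by move=> /(_ (conj Ex Fx)).
- move=> E _ dE E0 e e0.
  (* The finitely many atoms all leave the decreasing sets after the largest of these indices, where
     [w] vanishes. *)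
  have /choice[N xN] : forall A : a, exists n, ~ E n (x A).
    move=> A; apply: contrapT => /forallNP h.
    suff : (\bigcap_n E n) (x A) by rewrite E0.
    by move=> n _; apply: contrapT; exact: h.
  exists (\max_(A : a) N A)%N; rewrite /w big1 // => A _.
  rewrite indicE memNset ?mulr0 // => h; apply: (xN A).
  apply: subset_decreasing dE _ _ _ _ h; exact: leq_bigmax.
exists (exist _ Q (polish_radon pT Q) : M1 R T); apply/funext => A.
rewrite /vecof /= QE; last exact: am.
rewrite /w (bigD1 A) //= big1 ?addr0.
  by rewrite indicE mem_set ?mulr1.
move=> B BA; rewrite indicE memNset ?mulr0 // => h.
by move: BA; rewrite (partition_uniq pa h (xA B)) eqxx.
Qed.

End partitions.

(** * The content on cylinders *)

Section finitely_additive.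
Context (R : realType) (T : Type) (G : set (set T)) (p : set T -> R).
Hypotheses (Galg : set_algebra G) (p0 : forall A, G A -> 0 <= p A).
Hypothesis pU : forall A B, G A -> G B -> A `&` B = set0 ->
  p (A `|` B) = p A + p B.

Let GI : setI_closed G. Proof. exact: set_algebraI. Qed.
Let GD A B : G A -> G B -> G (A `\` B).
Proof.
by move=> GA GB; rewrite setDE; apply: GI => //; case: Galg => _ _ GC; exact: GC.
Qed.

Lemma additive_setD A B : G A -> G B -> p A = p (A `&` B) + p (A `\` B).
Proof.
move=> GA GB; rewrite -pU; first by rewrite setUIDK.
- exact: GI.
- exact: GD.
- by rewrite -subset0 => x [[_ Bx] [_ nB]].
Qed.

Lemma additive_le A B : G A -> G B -> A `<=` B -> p A <= p B.
Proof.
move=> GA GB AB; rewrite (additive_setD GB GA) (setIidr AB) lerDl.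
by apply: p0; exact: GD.
Qed.

Lemma additive_subadditive A B : G A -> G B -> p (A `|` B) <= p A + p B.
Proof.
move=> GA GB; have -> : A `|` B = A `|` (B `\` A).
  apply/seteqP; split => x [Ax|]; [by left| |by left|by case; right].
  by move=> Bx; have [?|?] := pselect (A x); [left|right].
rewrite pU //.
- rewrite lerD2l; apply: additive_le => //; first exact: GD.
- exact: GD.
- by rewrite setDIK.
Qed.

(** Intersecting with [B i] removes at most p(A \ B i). This shows later that finitely many
    constraints on measures are compatible. *)
Lemma additive_bigcap_ge A (B : nat -> set T) (e : nat -> R) (n : nat) : G A ->
  (forall i, (i < n)%N -> G (B i) /\ p (A `\` B i) <= e i) ->
  G (A `&` [set x | forall i, (i < n)%N -> B i x]) /\
  p A - \sum_(i < n) e i <= p (A `&` [set x | forall i, (i < n)%N -> B i x]).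
Proof.
move=> GA; elim: n => [|n IH] h.
  by rewrite big_ord0 subr0 (_ : mkset _ = setT) ?setIT //; apply/seteqP; split.
have [|G1 h1] := IH; first by move=> i ni; apply: h; rewrite ltnS ltnW.
have [GB Be] := h n (ltnSn n).
set X := A `&` _ in G1 h1.
have -> : A `&` [set x | forall i, (i < n.+1)%N -> B i x] = X `&` B n.
  apply/seteqP; split => x.
    move=> [Ax Bx]; split; last exact: Bx.
    by split => // i ni; apply: Bx; exact: ltnW.
  move=> [[Ax Bx] Bn]; split => // i; rewrite ltnS leq_eqVlt => /predU1P[-> //|].
  exact: Bx.
split; first exact: GI.
rewrite big_ord_recr /= opprD addrA.
have := additive_setD G1 GB.
have : p (X `\` B n) <= p (A `\` B n).
  apply: additive_le; [exact: GD|exact: GD|].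
  by apply: setSD; rewrite /X; exact: subIsetl.
move: Be h1; lra.
Qed.

End finitely_additive.

Lemma sum_half_le1 (R : realType) (n : nat) : \sum_(i < n) (2 ^ i.+1)%:R^-1 <= 1 :> R.
Proof.
suff -> : \sum_(i < n) (2 ^ i.+1)%:R^-1 = 1 - (2 ^ n)%:R^-1 :> R.
  by rewrite gerBl invr_ge0 ler0n.
elim: n => [|n IH]; first by rewrite big_ord0 expn0 invr1 subrr.
rewrite big_ord_recr /= IH expnS natrM invfM.
by set q := _^-1; lra.
Qed.

Section hull.
Context (R : realType) (T : ptopologicalType).
Implicit Types (a c : {fset (set T)}) (K : set T).

(** For a partition, the smallest union of pieces containing [K]; its mass is the sum in the
    tightness condition ([hull_mass]). *)
Definition hull a K : set T := [set x | exists2 A : a, fsval A x & fsval A `&` K !=set0].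

Lemma hull_saturated a K : is_partition a -> saturated a (hull a K).
Proof.
move=> pa B; have [BK|nBK] := pselect (fsval B `&` K !=set0).
  by left => x Bx; exists B.
right; rewrite -subset0 => x [Bx [A Ax AK]]; apply: nBK.
by rewrite (partition_uniq pa Bx Ax).
Qed.

Lemma sub_hull a K : is_partition a -> K `<=` hull a K.
Proof.
by move=> pa x Kx; have [A Ax] := partition_cover x pa; exists A => //; exists x.
Qed.

Lemma hull_refines a c K : refines a c -> hull c K `<=` hull a K.
Proof.
move=> ac x [A Ax [y [Ay Ky]]]; have [B AB] := ac A.
by exists B; [exact: AB|exists y; split => //; exact: AB].
Qed.

Lemma hull_mass a K (P : M1 R T) : is_partition a ->
  mass (hull a K) P =
  \sum_(A : a | `[< fsval A `&` K !=set0 >]) vecof a (P : M1t R T) A.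
Proof.
move=> pa; rewrite (saturated_mass P pa (@hull_saturated a K pa)).
apply: eq_bigl => A; apply/asboolP/asboolP => [Ah|AK x Ax]; last by exists A.
have [x Ax] : fsval A !=set0 by case: pa.
by have [B Bx BK] := Ah _ Ax; rewrite (partition_uniq pa Ax Bx).
Qed.

Lemma saturated_hull_disjoint a K D : is_partition a -> saturated a D ->
  D `&` K = set0 -> D `&` hull a K = set0.
Proof.
move=> pa sD DK; rewrite -subset0 => x [Dx [A Ax [y [Ay Ky]]]].
have [AD|AD] := sD A; last by rewrite -AD.
suff : (D `&` K) y by rewrite DK.
by split => //; exact: AD.
Qed.

End hull.

Section chain.
Context (R : realType) (T : ptopologicalType) (U : set (set T)).
Context (b : nat -> {fset (set T)}).
Variable Pi : forall a : {fset (set T)}, probability (borel (Rvec R a)) R.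
Hypothesis pT : polish R T.
Hypothesis bp : forall n, is_partition (b n).
Hypothesis br : forall n, refines (b n) (b n.+1).
Hypothesis bhat : forall n (A : b n), hat_clopen U (fsval A).
Hypothesis bgen : <<s [set A | exists n, exists B : b n, fsval B = A] >> = <<s @open T >>.
Hypothesis Pis : forall n, Pi (b n) (simplex (b n)) = 1%E.
Hypothesis Pic : forall m n, (m <= n)%N -> forall S, <<s @open (Rvec R (b m)) >> S ->
  Pi (b m) S = Pi (b n) [set q | S (phi (b m) (b n) q)].

Lemma chain_refines m n : (m <= n)%N -> refines (b m) (b n).
Proof.
elim: n => [|n IH]; first by rewrite leqn0 => /eqP -> B; exists B.
rewrite leq_eqVlt => /predU1P[-> B|]; first by exists B.
by rewrite ltnS => /IH h; exact: refines_trans h _.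
Qed.

Definition chain_algebra : set (set T) := [set D | exists n, saturated (b n) D].

Lemma chain_algebraP : set_algebra chain_algebra.
Proof.
split.
- by exists 0%N; have [] := saturated_algebra (b 0%N).
- move=> D E [m sD] [n sE]; exists (maxn m n).
  have [_ sU _] := saturated_algebra (b (maxn m n)).
  apply: sU; first by apply: saturated_refines sD; apply: chain_refines; rewrite leq_maxl.
  by apply: saturated_refines sE; apply: chain_refines; rewrite leq_maxr.
- by move=> D [n sD]; exists n; have [_ _ sC] := saturated_algebra (b n); exact: sC.
Qed.

Lemma chain_algebra_hat D : chain_algebra D -> hat_clopen U D.
Proof.
have [h0 hU _] := @hat_clopen_algebra T U.
move=> [n sD]; rewrite (saturatedE (bp n) sD).
by elim/big_ind : _ => // A _; exact: bhat.
Qed.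

Lemma chain_algebra_borel D : chain_algebra D -> <<s @open T >> D.
Proof. by move=> [n sD]; exact: saturated_borel sD. Qed.

Lemma chain_algebra_gen : <<s chain_algebra >> = <<s @open T >>.
Proof.
apply/seteqP; split.
  apply: smallest_sub; first exact: smallest_sigma_algebra.
  exact: chain_algebra_borel.
rewrite -bgen; apply: sub_sigma_algebra2 => _ [n [B <-]].
by exists n; exact: saturated_piece.
Qed.

Definition cyl n (S : set (Rvec R (b n))) : set (M1t R T) :=
  [set P : M1t R T | S (vecof (b n) P)].

(** Bases are taken inside the simplex, the range of [vecof], because there a base is determined by
    its cylinder. *)
Definition cylinders : set (set (M1t R T)) := [set C | exists n,
  exists S : set (Rvec R (b n)), [/\ <<s @open (Rvec R (b n)) >> S,
    S `<=` simplex (b n) & C = cyl S]].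

Let msimplex n : <<s @open (Rvec R (b n)) >> (simplex (b n)).
Proof. by apply: (@closed_borel (Rvec R (b n))); exact: simplex_closed. Qed.

Let mI n (S S' : set (Rvec R (b n))) : <<s @open (Rvec R (b n)) >> S ->
  <<s @open (Rvec R (b n)) >> S' -> <<s @open (Rvec R (b n)) >> (S `&` S').
Proof. exact: (@measurableI _ (borel (Rvec R (b n)))). Qed.

Lemma Pi_simplexI n S : <<s @open (Rvec R (b n)) >> S ->
  Pi (b n) (S `&` simplex (b n)) = Pi (b n) S.
Proof.
move=> mS; apply/eqP; rewrite eq_le; apply/andP; split.
  by apply: le_probability => //; exact: mI.
have mC : measurable (~` simplex (b n) : set (borel (Rvec R (b n)))).
  by apply: measurableC; exact: msimplex.
apply: (@le_trans _ _ (Pi (b n) ((S `&` simplex (b n)) `|` ~` simplex (b n)))).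
  apply: le_probability => //; first by apply: measurableU => //; exact: mI.
  by move=> x Sx; have [?|?] := pselect (simplex (b n) x); [left|right].
apply: (le_trans (measureU2 _ _ _)) => //; first exact: mI.
have Z : Pi (b n) (~` simplex (b n)) = 0%E.
  rewrite probability_setC; last exact: msimplex.
  by rewrite [X in (_ - X)%E](Pis n) subee.
by rewrite -[leRHS]adde0; apply: leeD => //; rewrite [leLHS]Z.
Qed.

Lemma cylI_simplex n (S : set (Rvec R (b n))) : cyl (S `&` simplex (b n)) = cyl S.
Proof.
apply/seteqP; split => P /=; first by case.
by move=> SP; split => //; exact: vecof_simplex.
Qed.

Lemma cylinders_cyl n (S : set (Rvec R (b n))) :
  <<s @open (Rvec R (b n)) >> S -> cylinders (cyl S).
Proof.
move=> mS; exists n, (S `&` simplex (b n)); split => //; last by rewrite cylI_simplex.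
exact: mI.
Qed.

Lemma cyl_lift m n (S : set (Rvec R (b m))) : (m <= n)%N ->
  cyl S = cyl ([set q | S (phi (b m) (b n) q)] `&` simplex (b n)).
Proof.
move=> mn; rewrite cylI_simplex /cyl /=; apply/funext => P /=.
by rewrite phi_vecof //; exact: chain_refines.
Qed.

(** Every point of the simplex is the vector of some measure, so [cyl] forgets no part of [S]. *)
Lemma sub_cyl n (S S' : set (Rvec R (b n))) : S `<=` simplex (b n) ->
  cyl S `<=` cyl S' -> S `<=` S'.
Proof.
move=> Ss CC p Sp; have [P Pp] := vecof_surj pT (bp n) (Ss _ Sp).
by rewrite -Pp; apply: CC; rewrite /cyl /= Pp.
Qed.

(** Lifted to the common level max(m, n), both bases have the same trace on the simplex, which
    carries all the mass. *)
Lemma cyl_Pi m n (S : set (Rvec R (b m))) (S' : set (Rvec R (b n))) :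
  <<s @open (Rvec R (b m)) >> S -> <<s @open (Rvec R (b n)) >> S' ->
  cyl S = cyl S' -> Pi (b m) S = Pi (b n) S'.
Proof.
move=> mS mS' CC; pose N := maxn m n.
have mN : (m <= N)%N by exact: leq_maxl.
have nN : (n <= N)%N by exact: leq_maxr.
rewrite (Pic mN mS) (Pic nN mS') -Pi_simplexI; last exact: phi_measurable.
rewrite -[RHS]Pi_simplexI; last exact: phi_measurable.
congr (Pi (b N) _); apply/seteqP; split; apply: sub_cyl.
- by move=> p [].
- by rewrite -(cyl_lift _ mN) -(cyl_lift _ nN) CC.
- by move=> p [].
- by rewrite -(cyl_lift _ mN) -(cyl_lift _ nN) CC.
Qed.

(* Does not depend on the representation of C, by [cyl_Pi]; it is 0 off the cylinders. *)
Definition cylinder_content (C : set (M1t R T)) : R := xget 0 [set r | exists n,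
  exists S : set (Rvec R (b n)), [/\ <<s @open (Rvec R (b n)) >> S,
    C = cyl S & r = fine (Pi (b n) S)]].

Lemma cylinder_contentE n (S : set (Rvec R (b n))) :
  <<s @open (Rvec R (b n)) >> S -> cylinder_content (cyl S) = fine (Pi (b n) S).
Proof.
move=> mS; rewrite /cylinder_content; case: xgetP => [r _ [m [S' [mS' CC ->]]]|].
  by rewrite (cyl_Pi mS mS' CC).
move=> /(_ (fine (Pi (b n) S)))/= nh; exfalso; apply: nh.
by exists n, S.
Qed.

(** In a chain any two cylinders share a level. With [S] inside the simplex, disjoint cylinders have
    disjoint bases, by [vecof_surj]. *)
Lemma cylinders_pair C D : cylinders C -> cylinders D -> exists n,
  exists S S' : set (Rvec R (b n)), [/\ <<s @open (Rvec R (b n)) >> S,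
    <<s @open (Rvec R (b n)) >> S', S `<=` simplex (b n), C = cyl S & D = cyl S'].
Proof.
move=> [m [S [mS _ ->]]] [n [S' [mS' _ ->]]]; pose N := maxn m n.
have mN : (m <= N)%N by exact: leq_maxl.
have nN : (n <= N)%N by exact: leq_maxr.
exists N, ([set q | S (phi (b m) (b N) q)] `&` simplex (b N)).
exists ([set q | S' (phi (b n) (b N) q)] `&` simplex (b N)); split.
- by apply: mI; [exact: phi_measurable|exact: msimplex].
- by apply: mI; [exact: phi_measurable|exact: msimplex].
- by move=> p [].
- exact: cyl_lift.
- exact: cyl_lift.
Qed.

Lemma cylinders_algebra : set_algebra cylinders.
Proof.
split.
- by exists 0%N, set0; split => //; exact: sigma_algebra0.
- move=> C D cC cD; have [n [S [S' [mS mS' _ -> ->]]]] := cylinders_pair cC cD.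
  have -> : cyl S `|` cyl S' = cyl (S `|` S') by [].
  by apply: cylinders_cyl; exact: (@measurableU _ (borel (Rvec R (b n)))).
- move=> _ [n [S [mS _ ->]]]; have -> : ~` cyl S = cyl (~` S) by [].
  by apply: cylinders_cyl; exact: (@measurableC _ (borel (Rvec R (b n)))).
Qed.

Lemma cylinder_content_ge0 C : cylinders C -> 0 <= cylinder_content C.
Proof. by move=> [n [S [mS _ ->]]]; rewrite cylinder_contentE // fine_ge0. Qed.

Lemma cylinder_contentT : cylinder_content setT = 1.
Proof.
have mT := @measurableT _ (borel (Rvec R (b 0%N))).
by rewrite (_ : setT = cyl (n := 0%N) setT) // cylinder_contentE // probability_setT.
Qed.

Lemma cylinder_contentU C D : cylinders C -> cylinders D -> C `&` D = set0 ->
  cylinder_content (C `|` D) = cylinder_content C + cylinder_content D.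
Proof.
move=> cC cD; have [n [S [S' [mS mS' Ss -> ->]]]] := cylinders_pair cC cD => CD.
have mU := @measurableU _ (borel (Rvec R (b n))) _ _ mS mS'.
rewrite (_ : cyl S `|` cyl S' = cyl (S `|` S')) //.
rewrite !cylinder_contentE // measureU //; last first.
  rewrite -subset0 => p [Sp S'p].
  have [P Pp] := vecof_surj pT (bp n) (Ss _ Sp).
  suff : (cyl S `&` cyl S') P by rewrite CD.
  by split; rewrite /cyl /= Pp.
by rewrite fineD // probability_fin.
Qed.


Hypothesis tight : forall eps delta : R, 0 < eps -> 0 < delta ->
  exists K : set (hatX U), compact K /\
    forall n, (Pi (b n) [set p : Rvec R (b n) |
      (\sum_(A : b n | `[< fsval A `&` K !=set0 >]) p A < 1 - delta)%R] < eps%:E)%E.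

Lemma cylinder_hull n K (r : R) :
  [set P : M1t R T | mass (hull (b n) K) P < r] =
  cyl [set p : Rvec R (b n) | \sum_(A : b n | `[< fsval A `&` K !=set0 >]) p A < r].
Proof. by apply/funext => P; rewrite /cyl /= hull_mass. Qed.

Let msum_lt n (Q : pred (b n)) (r : R) :
  <<s @open (Rvec R (b n)) >> [set p : Rvec R (b n) | \sum_(A : b n | Q A) p A < r].
Proof. by apply: sub_sigma_algebra; exact: Rvec_sum_lt_open. Qed.

Lemma chain_mass_vecof_cvg (F : set_system (M1 R T)) (P : M1 R T) n : Filter F ->
  (forall A, chain_algebra A -> mass A @ F --> mass A P) ->
  (fun P' : M1 R T => vecof (b n) (P' : M1t R T)) @ F --> vecof (b n) (P : M1t R T).
Proof.
move=> FF h; apply: Rvec_cvg => A.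
by apply: (h (fsval A)); exists n; exact: saturated_piece.
Qed.

(** Only the base is closed; what is used of [D] is stability under limits of the masses
    ([closed_cylinder_cvg]). *)
Definition closed_cylinder (D : set (M1t R T)) :=
  exists n, exists2 F : set (Rvec R (b n)), closed F & D = cyl F.

Lemma closed_cylinder_cvg (F : set_system (M1 R T)) (P : M1 R T) D :
  ProperFilter F -> (forall A, chain_algebra A -> mass A @ F --> mass A P) ->
  closed_cylinder D -> F D -> D (P : M1t R T).
Proof.
move=> FF h [n [C cC ->]] FD.
exact: (closed_cvg _ cC FD _ (chain_mass_vecof_cvg (n := n) _ h)).
Qed.

Lemma cylinder_inner_closed C (e : R) : cylinders C -> 0 < e ->
  exists D, [/\ closed_cylinder D, cylinders D, D `<=` C &
    cylinder_content (C `\` D) <= e].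
Proof.
move=> [n [S [mS _ ->]]] e0.
have [F [V [cF oV FS SV h]]] :=
  @borel_regular_set R _ (Pi (b n)) (@superlevel_Rvec R _) _ mS _ e0.
have mF := closed_borel cF; have mV := open_borel oV.
have mSF : <<s @open (Rvec R (b n)) >> (S `\` F).
  exact: (@measurableD _ (borel (Rvec R (b n)))).
exists (cyl F); split.
- by exists n, F.
- exact: cylinders_cyl.
- by move=> P; exact: FS.
- rewrite (_ : cyl S `\` cyl F = cyl (S `\` F)) // cylinder_contentE //.
  rewrite -lee_fin fineK ?probability_fin //; apply: le_trans h.
  apply: le_probability => //; last exact: setSD.
  by apply: measurableD.
Qed.

Lemma cylinder_content_continuous (C : nat -> set (M1t R T)) :
  (forall k, cylinders (C k)) -> (forall k, C k.+1 `<=` C k) ->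
  \bigcap_k C k = set0 -> forall e, 0 < e -> exists k, cylinder_content (C k) < e.
Proof.
move=> cC dC C0 e e0; apply: contrapT => /forallNP nC.
have CE k : e <= cylinder_content (C k) by rewrite leNgt; apply/negP; exact: nC.
have calg := cylinders_algebra; have [_ cU cCC] := calg.
have cD A B : cylinders A -> cylinders B -> cylinders (A `\` B).
  by move=> cA cB; rewrite setDE; apply: (set_algebraI calg) => //; exact: (cCC).
have dC' := subset_decreasing dC.
(* Constraint i costs [eps i] twice, once for the closed approximation and once for tightness; the
   total is at most e/2, less than the content of every [C N]. *)
pose eps (i : nat) : R := e / 4 * (2 ^ i.+1)%:R^-1.
have eps0 i : 0 < eps i.
  by rewrite /eps mulr_gt0 ?divr_gt0 // invr_gt0 ltr0n expn_gt0.
have /choice[K KP] : forall j : nat, exists K : set (hatX U), compact K /\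
    forall n, (Pi (b n) [set p : Rvec R (b n) |
      (\sum_(A : b n | `[< fsval A `&` K !=set0 >]) p A < 1 - j.+1%:R^-1)%R] < (eps j)%:E)%E.
  by move=> j; apply: tight => //; rewrite invr_gt0 ltr0n.
have /choice[D DP] : forall k, exists D, [/\ closed_cylinder D, cylinders D, D `<=` C k &
    cylinder_content (C k `\` D) <= eps k].
  by move=> k; exact: cylinder_inner_closed.
pose bad N j := [set P : M1t R T | mass (hull (b N) (K j)) P < 1 - j.+1%:R^-1].
have cbad N j : cylinders (bad N j).
  by rewrite /bad cylinder_hull; exact: cylinders_cyl.
have badE N j : cylinder_content (bad N j) <= eps j.
  rewrite /bad cylinder_hull cylinder_contentE //.
  have [_ /(_ N) h] := KP j.
  by rewrite -lee_fin fineK ?ltW // probability_fin //; exact: msum_lt.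
pose B N i := D i `\` bad N i.
have cB N i : cylinders (B N i) by have [_ cDi _ _] := DP i; exact: cD.
have CB N i : (i < N.+1)%N -> cylinder_content (C N `\` B N i) <= eps i + eps i.
  move=> iN; have [_ cDi DC h] := DP i.
  apply: (@le_trans _ _ (cylinder_content ((C i `\` D i) `|` bad N i))).
    apply: (additive_le calg cylinder_content_ge0 cylinder_contentU).
    - exact: cD.
    - by apply: cU => //; exact: cD.
    - move=> P [CP nB]; have [bP|nbP] := pselect (bad N i P); [by right|left].
      split; first exact: dC' CP.
      by move=> DP'; apply: nB.
  apply: (le_trans (additive_subadditive calg cylinder_content_ge0 cylinder_contentU _ _)) => //.
    exact: cD.
  by apply: lerD.
(* Only the constraints i <= N are imposed, all at level [N]: imposing infinitely many at once would
   require the countable additivity being proved. *)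
have /choice[P PP] : forall N, exists P : M1t R T,
    forall i, (i <= N)%N -> D i P /\ 1 - i.+1%:R^-1 <= mass (hull (b N) (K i)) P.
  move=> N.
  have [_ h] := @additive_bigcap_ge _ _ _ _ calg cylinder_content_ge0 cylinder_contentU
    (C N) (B N) (fun i => eps i + eps i) N.+1 (cC N) (fun i iN => conj (cB N i) (CB N i iN)).
  have [/seteqP[C0' _]|/set0P[P [CP BP]]] :=
      eqVneq (C N `&` [set x | forall i, (i < N.+1)%N -> B N i x]) set0.
    exfalso; move: h; apply/negP; rewrite -ltNge.
    rewrite (_ : _ `&` _ = set0); last by rewrite -subset0.
    have -> : cylinder_content set0 = 0.
      have := cylinder_contentU (C := set0) (D := set0); rewrite setU0 => /(_ _ _ (setI0 _)).
      have [c0 _ _] := calg; move=> /(_ c0 c0); lra.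
    rewrite subr_gt0; apply: (lt_le_trans _ (CE N)).
    rewrite big_split /= -mulr_sumr.
    have := sum_half_le1 R N.+1; set s := \sum_(i < _) _ => s1.
    have s2 : e / 4 * s <= e / 4 * 1 by rewrite ler_wpM2l // divr_ge0 // ltW.
    move: s2 e0; lra.
  exists P => i iN; have [DP' nb] := BP i iN; split => //.
  by rewrite leNgt; apply/negP.
have [F [UF sF]] := ultraFilterLemma (fmap_proper_filter (P : nat -> M1 R T) eventually_filter).
have FN (Q : set (M1 R T)) (n : nat) : (forall k, (n <= k)%N -> Q (P k)) -> F Q.
  by move=> h; apply: sF; exists n.
have [||Pinf Pcvg] := @ultra_limit R T U chain_algebra pT chain_algebraP _ chain_algebra_gen F UF.
- by move=> A /chain_algebra_hat[].
- move=> delta d0; have [j hj] := natSinv_lt d0.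
  have [cK _] := KP j; exists (K j); split => // A [n sA] AK.
  (* From level [n] on [A] is a union of pieces, hence disjoint from the hull of [K j]; from stage
     [j] on that hull has mass at least 1 - 1/(j+1). *)
  apply: (FN _ (maxn n j)) => k; rewrite geq_max => /andP[nk jk] /=.
  have [_ hk] := PP k j jk.
  have sAk : saturated (b k) A by apply: saturated_refines sA; exact: chain_refines.
  have AH := saturated_hull_disjoint (bp k) sAk AK.
  have mA := saturated_borel (bp k) sAk.
  have mH := saturated_borel (bp k) (@hull_saturated T (b k) (K j) (bp k)).
  have := mass_le1 (P k : M1 R T) ((@measurableU _ (borel T)) _ _ mA mH).
  rewrite massU //; move: hk hj; move: (mass _ _) (mass _ _) (_^-1) => x y z; lra.
(* [D k] contains [P i] for all i >= k, hence also the limit. *)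
suff : (\bigcap_k C k) (Pinf : M1t R T) by rewrite C0.
move=> k _; have [clD _ DC _] := DP k; apply: DC.
apply: (closed_cylinder_cvg (F := F) _ Pcvg clD).
by apply: (FN _ k) => i ki; have [] := PP i k ki.
Qed.

End chain.

(** * Prokhorov's theorem and the Radon property *)

Section hat_compact.
Context (T : ptopologicalType) (U : set (set T)).
Hypothesis bU : basis U.

Lemma nbhs_hat (x : T) (A : set T) : nbhs x A -> nbhs (x : hatX U) A.
Proof.
have [_ Ub] := bU; move=> /Ub[W [UW Wx] WA].
have nW : nbhs (x : hatX U) W.
  apply: (@open_nbhs_nbhs (hatX U)); split => //.
  by apply: hat_subbase_open; left.
exact: (@filterS _ (nbhs (x : hatX U)) (nbhs_filter (x : hatX U)) W A WA nW).
Qed.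

Lemma hat_compact (K : set (hatX U)) : compact K -> compact (K : set T).
Proof.
move=> cK F FF FK; have [x [Kx Fx]] := cK F FF FK.
by exists x; split => // A B FA nB; apply: Fx => //; exact: nbhs_hat.
Qed.

End hat_compact.

Lemma sigma_separates (T : Type) (S : set (set T)) (x y : T) :
  (forall A, S A -> (A x <-> A y)) -> forall A, <<s S >> A -> (A x <-> A y).
Proof.
move=> h; apply: smallest_sub => //; split => //.
- by move=> A xy; rewrite setTD; split => nA /xy.
- by move=> F xy; split => -[n _ /xy Fn]; exists n.
Qed.

Section clopen_gen.
Context (T : ptopologicalType) (U : set (set T)).
Hypotheses (cU : countable U) (bU : basis U).

(** It contains [U], which [chain_algebra] need not, so convergence on it yields tight
    convergence. *)
Definition hat_algebra := @hat_clopen T U `&` <<s @open T >>.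

Lemma hat_algebraP : set_algebra hat_algebra.
Proof.
apply: set_algebra_setI; first exact: hat_clopen_algebra.
exact: set_algebra_sigma.
Qed.

Lemma hat_algebra_basis V : U V \/ V = set0 -> hat_algebra V.
Proof.
move=> [UV|->]; last by have [] := hat_algebraP.
split; first exact: hat_clopen_basic.
by apply: sub_sigma_algebra; have [] := bU => + _; exact.
Qed.

Lemma hat_algebra_gen : <<s hat_algebra >> = <<s @open T >>.
Proof.
apply/seteqP; split.
  apply: smallest_sub; first exact: smallest_sigma_algebra.
  by move=> A [].
apply: smallest_sub; first exact: smallest_sigma_algebra.
have [u [[uo ub] uU]] := countable_basis_enum cU bU.
move=> V oV; have -> : V = \bigcup_(n in [set n | u n `<=` V]) u n.
  apply/seteqP; split => x; last by move=> [n /= uV /uV].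
  by move=> Vx; have [n [ux uV]] := ub V x oV Vx; exists n.
rewrite bigcup_mkcond; apply: sigma_algebra_bigcup => n.
case: ifP => _; last exact: sigma_algebra0.
by apply: sub_sigma_algebra; exact: hat_algebra_basis.
Qed.

End clopen_gen.

Section tight_sets.
Context (R : realType) (T : ptopologicalType) (U : set (set T)).
Hypotheses (pT : polish R T) (cU : countable U) (bU : basis U).
Variable K : nat -> set (hatX U).
Hypothesis cK : forall j, compact (K j).

Lemma hat_compact_closed j : closed (K j : set T).
Proof.
by apply: compact_closed; [exact: (polish_hausdorff pT)|exact: (hat_compact bU (cK (j:=j)))].
Qed.

Let mK j : <<s @open T >> (K j : set T).
Proof. by apply: closed_borel; exact: hat_compact_closed. Qed.

Definition tight_set : set (M1t R T) :=
  [set P | forall j : nat, 1 - j.+1%:R^-1 <= mass (K j) P].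

Lemma setC_tight_set : ~` tight_set =
  \bigcup_j [set P : M1t R T | mass (K j) P < 1 - j.+1%:R^-1].
Proof.
apply/seteqP; split => P.
  move=> /existsNP[j h]; exists j => //=; rewrite ltNge; exact/negP.
by move=> [j _ /= h] /(_ j); rewrite leNgt h.
Qed.

Lemma tight_set_closed : closed tight_set.
Proof.
have [u [ub _]] := countable_basis_enum cU bU.
rewrite -[tight_set]setCK; apply: open_closedC; rewrite setC_tight_set.
apply: bigcup_open => j _.
rewrite (_ : mkset _ = [set P : M1t R T | j.+1%:R^-1 < mass (~` (K j : set T)) P]).
  apply: (open_mass_gt pT); apply: closed_openC.
  exact: hat_compact_closed.
apply/seteqP; split => P /=; rewrite massC //.
  by move: (_^-1) => q; lra.
by move: (_^-1) => q; lra.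
Qed.

(** The masses converge on [hat_algebra], in particular on finite unions of basic sets, so
    [liminf_open_base] gives tight convergence; closedness keeps the limit in the set. *)
Lemma tight_set_compact : compact tight_set.
Proof.
have [u [ub uU]] := countable_basis_enum cU bU.
rewrite compact_ultra => F UF FQ.
have [||P PP] := @ultra_limit R T U (@hat_algebra T U) pT (@hat_algebraP T U) _
    (hat_algebra_gen cU bU) F UF.
- by move=> A [[]].
- move=> delta d0; have [j hj] := natSinv_lt d0.
  exists (K j); split => // A [_ mA] AK.
  apply: filterS FQ => P /(_ j) h /=.
  have := mass_le1 (P : M1 R T) ((@measurableU _ (borel T)) _ _ mA (mK j)).
  by rewrite massU //; move: h hj; move: (mass _ _) (mass _ _) (_^-1) => x y z; lra.
have FP : F --> (P : M1t R T).
  apply: liminf_cvg; apply: (liminf_open_base ub) => s q qs.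
  suff /PP/cvgr_gt/(_ _ qs) : hat_algebra U (fin_union u s) by [].
  rewrite /fin_union; have [h0 hU _] := @hat_algebraP T U.
  rewrite bigcup_seq; elim/big_ind : _ => // i _.
  exact: hat_algebra_basis.
exists P; split => //.
exact: (@closed_cvg _ _ F _ id _ tight_set_closed FQ (P : M1t R T) FP).
Qed.

End tight_sets.

Section chain_measure.
Context (R : realType) (T : ptopologicalType) (U : set (set T)).
Context (b : nat -> {fset (set T)}).
Variable Pi : forall a : {fset (set T)}, probability (borel (Rvec R a)) R.
Hypotheses (pT : polish R T) (cU : countable U) (bU : basis U).
Hypothesis bp : forall n, is_partition (b n).
Hypothesis br : forall n, refines (b n) (b n.+1).
Hypothesis bhat : forall n (A : b n), hat_clopen U (fsval A).
Hypothesis bgen : <<s [set A | exists n, exists B : b n, fsval B = A] >> = <<s @open T >>.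

Lemma vecof_measurable (a : {fset (set T)}) (S : set (Rvec R a)) : is_partition a ->
  <<s @open (Rvec R a) >> S -> <<s @open (M1t R T) >> [set P | S (vecof a P)].
Proof.
move=> pa mS.
pose C : set (set (Rvec R a)) := 
  [set A | exists i r, A = [set p | r < p i] \/ A = [set p | p i < r]].
have sub : <<s @open (Rvec R a) >> `<=` <<s C >>.
  apply: smallest_sub; first exact: smallest_sigma_algebra.
  apply: open_Rvec_sigma => i r; apply: sub_sigma_algebra; exists i, r; by [left|right].
apply: (@preimage_sigma _ _ (vecof a) (@open (M1t R T)) C) (sub _ mS).
have mi (i : a) : <<s @open T >> (fsval i) by case: pa.
move=> _ [i [r [->|->]]]; last exact: (measurable_mass_lt pT r (mi i)).
exact: (measurable_superlevel r (measurable_mass pT (mi i))).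
Qed.

(** On the algebra of the chain the mass is a finite sum of coordinates, hence cylinder-measurable;
    the Dynkin argument extends this to open sets, whose masses generate the tight Borel sets. *)
Lemma cylinders_gen : <<s @open (M1t R T) >> = <<s @cylinders R T b >>.
Proof.
have [u [ub _]] := countable_basis_enum cU bU.
apply/seteqP; split.
  apply: smallest_sub; first exact: smallest_sigma_algebra.
  apply: (open_M1t_sigma ub) => V q oV.
  have CE := chain_algebra_gen bp bgen.
  apply: (measurable_superlevel q (X := g_sigma_algebraType (@cylinders R T b))).
  apply: (measurable_mass_sigma (G := chain_algebra b)) => //.
  - by apply: set_algebraI; exact: chain_algebraP.
  - move=> A r [n sA]; apply: sub_sigma_algebra.
    rewrite (_ : mkset _ = cyl (n := n) [set p : Rvec R (b n) |
        r < \sum_(B : b n | `[< fsval B `<=` A >]) p B]).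
      apply: cylinders_cyl => //; apply: sub_sigma_algebra.
      by apply: open_superlevel; exact: Rvec_sum_continuous.
    by apply/funext => P; rewrite /cyl /= (saturated_mass P (bp n) sA).
  - exact: sub_sigma_algebra.
apply: smallest_sub; first exact: smallest_sigma_algebra.
by move=> _ [n [S [mS _ ->]]]; exact: vecof_measurable.
Qed.

(* The pieces containing x decrease along the chain and meet K, hence by compactness
   contain a common point of K; it is x because the pieces separate points. *)
Lemma hull_bigcap (K : set (hatX U)) : compact K ->
  \bigcap_n hull (b n) K = K.
Proof.
move=> cK; apply/seteqP; split; last first.
  by move=> x Kx n _; exact: sub_hull.
move=> x hx.
have /choice[B BP] : forall n, exists B : set T, (exists A : b n, fsval A = B) /\ B x.
  by move=> n; have [A Ax] := partition_cover x (bp n); exists (fsval A); split => //; exists A.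
have BK n : B n `&` K !=set0.
  have [[A AB] Bx] := BP n; have [A' A'x A'K] := hx n I.
  by rewrite -AB; rewrite -AB in Bx; rewrite (partition_uniq (bp n) Bx A'x).
have [y [By Ky]] : (\bigcap_n B n) `&` K !=set0.
  apply/set0P/eqP => h.
  have [||n nK] := @compact_decreasing_empty (hatX U) K B cK _ _ h.
  - by move=> n; have [[A <-] _] := BP n; have [] := bhat A.
  - move=> n; have [[A AB] Bx] := BP n.+1; have [[A' AB'] B'x] := BP n.
    have [A'' AA''] := br A.
    have -> : B n = fsval A''.
      rewrite -AB' (partition_uniq (bp n) (A := A') (B := A'') (x := x)) ?AB' //.
      by apply: AA''; rewrite AB.
    by rewrite -AB.
  - by have := BK n; rewrite nK => -[].
suff -> : x = y by [].
have sep : forall A, <<s @open T >> A -> (A x <-> A y).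
  rewrite -bgen; apply: sigma_separates => _ [n [A <-]].
  have [[A' AB] Bx] := BP n; have By' := By n I.
  rewrite -AB in Bx By'.
  by split => Ax; rewrite -?(partition_uniq (bp n) Bx Ax) // -(partition_uniq (bp n) By' Ax).
have cx : closed [set x].
  by apply: compact_closed (@compact_set1 T x); exact: polish_hausdorff pT.
by have [+ _] := sep _ (@closed_borel T _ cx); move=> /(_ erefl).
Qed.

Hypothesis Pis : forall n, Pi (b n) (simplex (b n)) = 1%E.
Hypothesis Pic : forall m n, (m <= n)%N -> forall S, <<s @open (Rvec R (b m)) >> S ->
  Pi (b m) S = Pi (b n) [set q | S (phi (b m) (b n) q)].
Hypothesis tight : forall eps delta : R, 0 < eps -> 0 < delta ->
  exists K : set (hatX U), compact K /\
    forall n, (Pi (b n) [set p : Rvec R (b n) |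
      (\sum_(A : b n | `[< fsval A `&` K !=set0 >]) p A < 1 - delta)%R] < eps%:E)%E.

Lemma chain_measure_exists : exists Q : probability (borel (M1t R T)) R,
  radon Q /\ forall n S, <<s @open (Rvec R (b n)) >> S ->
    Q [set P | S (vecof (b n) P)] = Pi (b n) S.
Proof.
have calg : set_algebra (@cylinders R T b) by exact: cylinders_algebra.
have [Q [QC Qmono]] := @algebra_extension R (M1t R T) (@cylinders R T b) (@open (M1t R T))
  (cylinder_content b Pi) calg cylinders_gen
  (cylinder_content_ge0 pT bp br Pis Pic) (cylinder_contentT pT bp br Pis Pic)
  (cylinder_contentU pT bp br Pis Pic)
  (cylinder_content_continuous pT bp br bhat bgen Pis Pic tight).
have QE n S : <<s @open (Rvec R (b n)) >> S ->
    Q [set P | S (vecof (b n) P)] = Pi (b n) S.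
  move=> mS; rewrite QC; last exact: cylinders_cyl.
  rewrite (cylinder_contentE pT bp br Pis Pic mS) fineK //.
  exact: probability_fin.
exists Q; split => //.
have [u [ub _]] := countable_basis_enum cU bU.
apply: tight_radon; first exact: superlevel_M1t pT ub.
  (* Compact sets of measures may be non-measurable; the extension is monotone on them as an outer
     measure. *)
  by move=> K B _ _; exact: Qmono.
move=> e e0.
have eps0 (j : nat) : 0 < e / (2 ^ j.+1)%:R :> R.
  by rewrite divr_gt0 // ltr0n expn_gt0.
have /choice[K KP] : forall j : nat, exists K : set (hatX U), compact K /\
    forall n, (Pi (b n) [set p : Rvec R (b n) |
      (\sum_(A : b n | `[< fsval A `&` K !=set0 >]) p A < 1 - j.+1%:R^-1)%R] <
      (e / (2 ^ j.+1)%:R)%:E)%E.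
  by move=> j; apply: tight => //; rewrite invr_gt0 ltr0n.
have cK j : compact (K j) by have [] := KP j.
exists (@tight_set R T U K).
  by split; [exact: (tight_set_compact pT cU bU cK)|exact: (tight_set_closed pT cU bU cK)].
rewrite setC_tight_set.
have mK j : <<s @open T >> (K j).
  by apply: (@closed_borel T); exact: (hat_compact_closed pT bU cK).
have mH j n : <<s @open T >> (hull (b n) (K j)).
  by apply: saturated_borel (bp n) _; exact: hull_saturated.
pose bad j n := [set P : M1t R T | mass (hull (b n) (K j)) P < 1 - j.+1%:R^-1].
apply: probability_bigcup_le; first exact: ltW.
  by move=> j; exact: measurable_mass_lt.
move=> j.
(* The hulls decrease to [K j], so a deficit of mass on [K j] already shows at some finite level. *)
have -> : [set P : M1t R T | mass (K j) P < 1 - j.+1%:R^-1] = \bigcup_n bad j n.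
  apply/seteqP; split => P /=; last first.
    move=> [n _]; rewrite /bad /=; apply: le_lt_trans; apply: le_mass => //.
    exact: sub_hull.
  move=> KPj.
  have : (j.+1%:R^-1%:E < sval (P : M1 R T) (\bigcup_n ~` (hull (b n) (K j))))%E.
    rewrite -setC_bigcap hull_bigcap // massE; last exact: (@measurableC _ (borel T) _ (mK j)).
    by rewrite lte_fin massC //; move: KPj; move: (_^-1) => q; lra.
  move=> /probability_gt_bigcup[].
  - by move=> n; apply: (@measurableC _ (borel T)); exact: mH.
  - by move=> n; apply: subsetC; exact: hull_refines.
  - move=> n; rewrite massE; last by apply: (@measurableC _ (borel T)); exact: mH.
    rewrite lte_fin massC // => h; exists n => //; rewrite /bad /=.
    by move: h; move: (_^-1) => q; lra.
(* These events increase with the level, so the bound valid at each level passes to their union. *)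
rewrite leNgt; apply/negP => /probability_gt_bigcup[].
- by move=> n; exact: measurable_mass_lt.
- move=> n P; rewrite /bad /=; apply: le_lt_trans; apply: le_mass => //.
  exact: hull_refines.
- move=> n; rewrite /bad cylinder_hull // QE.
    by have [_ /(_ n) h] := KP j; rewrite ltNge (ltW h).
  by apply: sub_sigma_algebra; exact: Rvec_sum_lt_open.
Qed.

End chain_measure.

(** * Necessity *)

Section hat_tight.
Context (R : realType) (T : ptopologicalType) (U : set (set T)).
Hypotheses (pT : polish R T) (cU : countable U) (bU : basis U).

Lemma hat_tight (nu : probability (borel T) R) (e : R) : 0 < e ->
  exists K : set (hatX U), [/\ compact K, closed (K : set T) & (nu (~` K) <= e%:E)%E].
Proof.
move=> e0; have e20 : 0 < e / 2 by rewrite divr_gt0.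
have [u [[uo _] uU]] := countable_basis_enum cU bU.
have [u' [_ Uu']] := countable_enum set0 cU.
pose v n := if `[< U (u' n) >] then u' n else set0.
have vo n : open (v n).
  by rewrite /v; case: asboolP => [/bU.1 //|_]; exact: open0.
have Uv V : U V -> exists n, v n = V.
  by move=> UV; have [n nV] := Uu' _ UV; exists n; rewrite /v nV asboolT.
have [K0 [kK0 cK0] hK0] := polish_tight pT nu e20.
have eps0 (n : nat) : 0 < e / 2 / (2 ^ n.+1)%:R :> R.
  by rewrite divr_gt0 // ltr0n expn_gt0.
(* On K the open set v n coincides with the closed set F n, so that it is clopen in
   K already for the original topology. *)
have /choice[F FP] : forall n, exists F : set T, [/\ closed F, F `<=` v n &
    (nu (v n `\` F) <= (e / 2 / (2 ^ n.+1)%:R)%:E)%E].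
  move=> n; have mv := open_borel (vo n).
  have [F [V [cF oV Fv vV h]]] := @borel_regular_set R T nu (polish_superlevel pT) _ mv _ (eps0 n).
  exists F; split => //; apply: le_trans h; apply: le_probability.
  - by apply: measurableD => //; exact: closed_borel.
  - by apply: measurableD; [exact: open_borel|exact: closed_borel].
  - exact: setSD.
have cF n : closed (F n) by have [] := FP n.
pose K : set T := K0 `&` \bigcap_n (F n `|` ~` v n).
have cFv n : closed (F n `|` ~` v n) by apply: closedU => //; exact: open_closedC.
have cK : closed K by apply: closedI => //; apply: closed_bigI.
have kK : compact K by apply: compact_closedI => //; apply: closed_bigI.
exists K; split => //; last first.
  have mvF n : measurable (v n `\` F n : set (borel T)).
    by apply: measurableD; [exact: open_borel|exact: closed_borel].
  have mB : measurable (\bigcup_n (v n `\` F n) : set (borel T)).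
    exact: bigcup_measurable.
  have mK0 : measurable (~` K0 : set (borel T)).
    by apply: measurableC; exact: closed_borel.
  apply: (@le_trans _ _ (nu (~` K0 `|` \bigcup_n (v n `\` F n)))).
    apply: le_probability.
    - by apply: measurableC; exact: closed_borel.
    - exact: measurableU.
    - move=> x nK; have [K0x|nK0] := pselect (K0 x); last by left.
      right; apply: contrapT => nB; apply: nK; split => // n _.
      have [vx|nvx] := pselect (v n x); last by right.
      by left; apply: contrapT => nF; apply: nB; exists n.
  apply: (le_trans (measureU2 _ mK0 mB)).
  rewrite [e in leRHS]splitr EFinD leeD //.
  apply: probability_bigcup_le => //; first exact: ltW.
  by move=> n; have [] := FP n.
rewrite compact_ultra => G UG GK.
have FG : ProperFilter G := @ultra_proper _ _ UG.
have := kK; rewrite compact_ultra => /(_ G UG GK)[x [Kx Gx]].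
exists x; split => //; apply: hat_cvg => V [UV Vx|[W UW ->] nWx].
  by apply: Gx; apply: open_nbhs_nbhs; split => //; exact: bU.1.
have [n nW] := Uv _ UW.
(* x lies outside the basic set, hence outside [F n], whose complement is open in the original
   topology. On [K] the basic set is contained in [F n], so points of [K] near x avoid it. *)
have GnF : G (~` F n).
  apply: Gx; apply: open_nbhs_nbhs; split; first exact: closed_openC.
  by move=> Fx; apply: nWx; rewrite -nW; have [_ + _] := FP n; exact.
apply: filterS (filterI GnF GK) => y [nFy [_ /(_ n I)]].
by rewrite nW; case.
Qed.

End hat_tight.

Section mean_measure.
Context (R : realType) (T : ptopologicalType).
Hypothesis pT : polish R T.
Variable Q : probability (borel (M1t R T)) R.

Definition mean_measure (A : set (borel T)) : \bar R :=
  (\int[Q]_(P in setT) (mass A P)%:E)%E.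

Let mean0 : mean_measure set0 = 0%E.
Proof.
rewrite /mean_measure; under eq_integral do rewrite /mass measure0 /=.
by rewrite integral0.
Qed.

Let mean_ge0 A : (0 <= mean_measure A)%E.
Proof. by apply: integral_ge0 => P _; rewrite lee_fin mass_ge0. Qed.

Let mean_sigma_additive : semi_sigma_additive mean_measure.
Proof.
move=> F mF tF mUF.
have -> : mean_measure (\bigcup_n F n) = (\sum_(k <oo) mean_measure (F k))%E.
  rewrite /mean_measure -integral_nneseries //.
  - apply: eq_integral => P _; rewrite -massE //.
    rewrite measure_bigcup //; apply: congr_lim; apply/funext => n.
    apply: eq_big => k; first by rewrite in_setT.
    by move=> _; exact: (massE P (mF k)).
  - by move=> n; apply/measurable_EFinP; apply: measurable_mass => //; exact: mF.
  - by move=> n P _; rewrite lee_fin mass_ge0.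
by apply: is_cvg_nneseries => n _ _; exact: mean_ge0.
Qed.

Let meanT : mean_measure setT = 1%E.
Proof.
rewrite /mean_measure; under eq_integral do rewrite massT.
rewrite integral_cst // mul1e; exact: probability_setT.
Qed.

HB.instance Definition _ := isMeasure.Build _ (borel T) R mean_measure
  mean0 mean_ge0 mean_sigma_additive.
HB.instance Definition _ := Measure_isProbability.Build _ (borel T) R mean_measure meanT.

Lemma mean_measure_exists : exists nu : probability (borel T) R,
  forall A, nu A = (\int[Q]_(P in setT) (mass A P)%:E)%E.
Proof. by exists mean_measure. Qed.

Lemma measurable_mass_ge (A : set T) (r : R) : <<s @open T >> A ->
  measurable ([set P | r <= mass A P] : set (borel (M1t R T))).
Proof.
move=> mA; rewrite (_ : mkset _ = ~` [set P : M1t R T | mass A P < r]).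
  by apply: measurableC; exact: measurable_mass_lt.
by apply/seteqP; split => P /=; rewrite leNgt => /negP.
Qed.

Lemma mean_tight (U : set (set T)) (eps delta : R) : countable U -> basis U ->
  0 < eps -> 0 < delta ->
  exists K : set (hatX U), [/\ compact K, closed (K : set T) &
    (Q [set P | (delta <= mass (~` (K : set T)) P)%R] < eps%:E)%E].
Proof.
move=> cU bU e0 d0; have [nu nuE] := mean_measure_exists.
(* Markov's inequality divides by [delta]; halving [eps] makes the resulting bound strict. *)
have ed : 0 < eps / 2 * delta by rewrite mulr_gt0 ?divr_gt0.
have [K [kK cK hK]] := hat_tight pT cU bU nu ed.
exists K; split => //.
have mK : <<s @open T >> (~` (K : set T)).
  by apply: (@measurableC _ (borel T)); exact: closed_borel.
have mf : measurable_fun setT (fun P : borel (M1t R T) => (mass (~` (K : set T)) P)%:E).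
  by apply/measurable_EFinP; exact: measurable_mass.
have := le_integral_abse Q measurableT mf d0.
rewrite setTI.
have -> : [set P : borel (M1t R T) | (delta%:E <= `|(mass (~` (K : set T)) P)%:E|)%E] =
    [set P | delta <= mass (~` (K : set T)) P].
  by apply/funext => P /=; rewrite lee_fin ger0_norm ?mass_ge0.
have -> : (\int[Q]_(P in setT) `|(mass (~` (K : set T)) P)%:E| = nu (~` K))%E.
  rewrite nuE; apply: eq_integral => P _.
  by rewrite /= ger0_norm // mass_ge0.
move=> /le_trans /(_ hK).
have mS := measurable_mass_ge delta mK.
have key : forall x : \bar R, x \is a fin_num ->
    (delta%:E * x <= (eps / 2 * delta)%:E)%E -> (x < eps%:E)%E.
  move=> [q| |] // _; rewrite -EFinM lee_fin lte_fin.
  rewrite mulrC ler_pM2r // => h; apply: (le_lt_trans h).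
  by rewrite ltr_pdivrMr // ltr_pMr // ltr1n.
by apply: key; exact: probability_fin.
Qed.

End mean_measure.

(** * The main theorem *)

Lemma seq_lift (X Y : eqType) (f : Y -> X) (s : seq X) :
  (forall x, x \in s -> exists y, f y = x) -> exists t, map f t = s.
Proof.
elim: s => [|x s IH] h; first by exists [::].
have [y yx] := h x (mem_head _ _).
have [|t ts] := IH; first by move=> z zs; apply: h; rewrite inE zs orbT.
by exists (y :: t); rewrite /= yx ts.
Qed.

Section partition_chain.
Context (T : ptopologicalType) (U : set (set T)) (As : set {fset (set T)}).
Hypothesis cU : countable U.
Hypothesis Ap : forall a, As a -> is_partition a /\ partition_generated_by U a.
Hypothesis Adir : directed As.

(** A generated set is a finite list of finite lists of literals, coded by the index of a basic set
    and a sign; such codes are countable. *)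
Lemma generated_by_enum : exists gen : seq (seq (nat * bool)) -> set T,
  forall A, generated_by U A -> exists s, gen s = A.
Proof.
have [u [_ uU]] := countable_enum set0 cU.
pose lit (p : nat * bool) : set T := if p.2 then u p.1 else ~` u p.1.
exists (fun s => \big[setU/set0]_(l <- map (map lit) s) \big[setI/setT]_(L <- l) L).
move=> A [s [sU ->]].
have [t <-] : exists t, map (map lit) t = s; last by exists t.
apply: seq_lift => l ls; apply: seq_lift => L Ll.
have [UL|[W UW ->]] := sU l ls L Ll.
  by have [n nL] := uU _ UL; exists (n, true).
by have [n nW] := uU _ UW; exists (n, false); rewrite /lit /= nW.
Qed.

Lemma partition_enum : exists v : nat -> {fset (set T)},
  forall a, As a -> exists n, v n = a.
Proof.
have [gen genP] := generated_by_enum.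
pose f (t : seq (seq (seq (nat * bool)))) : {fset (set T)} := [fset x in map gen t]%fset.
exists (fun n => odflt fset0 (omap f (choice.unpickle n))).
move=> a /Ap[_ ga].
have [t ta] : exists t, map gen t = enum_fset a.
  by apply: seq_lift => A Aa; apply: genP; exact: (ga [` Aa]%fset).
exists (choice.pickle t); rewrite choice.pickleK /= /f ta.
by apply/fsetP => x; rewrite inE.
Qed.

(** [b n.+1] is a common refinement of [b n] and the n-th listed partition. The list may contain
    values outside [As], which are skipped. *)
Lemma partition_chain : exists b : nat -> {fset (set T)},
  [/\ forall n, As (b n), forall n, refines (b n) (b n.+1) &
      forall a, As a -> exists n, refines a (b n)].
Proof.
have [v vA] := partition_enum; have [[a0 Aa0] dirA] := Adir.
have /choice[g gP] : forall p : nat * {fset (set T)}, exists c : {fset (set T)},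
    As p.2 -> [/\ As c, refines p.2 c & As (v p.1) -> refines (v p.1) c].
  move=> [n a] /=; have [Aa|nAa] := pselect (As a); last by exists a.
  have [Av|nAv] := pselect (As (v n)).
    by have [c Ac [ac vc]] := dirA _ _ Aa Av; exists c.
  by exists a => _; split => // B; exists B.
pose b := fix b n := if n is n'.+1 then g (n', b n') else a0.
have Ab n : As (b n) by elim: n => // n /(gP (n, b n))[].
exists b; split => //.
  by move=> n; have [] := gP (n, b n) (Ab n).
move=> a Aa; have [n va] := vA _ Aa; exists n.+1.
by have [_ _ /=] := gP (n, b n) (Ab n); rewrite va; exact.
Qed.

Lemma generated_hat_clopen (a : {fset (set T)}) (A : a) : As a -> hat_clopen U (fsval A).
Proof.
move=> /Ap[_ /(_ A)[s [sU ->]]].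
have halg := @hat_clopen_algebra T U; have [h0 hU hC] := halg.
have hT : hat_clopen U setT by rewrite -setC0; exact: hC.
rewrite big_seq; elim/big_ind : _ => // l ls.
rewrite big_seq; elim/big_ind : _ => // [|L Ll]; first exact: set_algebraI halg.
have [UL|[W UW ->]] := sU l ls L Ll; first exact: hat_clopen_basic.
by apply: hC; exact: hat_clopen_basic.
Qed.

Lemma chain_resolves (b : nat -> {fset (set T)}) : resolves As ->
  (forall n, As (b n)) -> (forall a, As a -> exists n, refines a (b n)) ->
  <<s [set A | exists n, exists B : b n, fsval B = A] >> = <<s @open T >>.
Proof.
move=> resA Ab cof; rewrite -resA; apply/seteqP; split.
  apply: sub_sigma_algebra2 => _ [n [B <-]].
  by exists (b n) => //; exists B.
apply: smallest_sub; first exact: smallest_sigma_algebra.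
move=> _ [a Aa [B <-]]; have [n an] := cof _ Aa.
have [pa _] := Ap Aa; have [pb _] := Ap (Ab n).
rewrite (saturatedE pb (saturated_refines an (saturated_piece B pa))).
apply: (@bigsetU_measurable _ (g_sigma_algebraType
  [set A | exists n, exists B : b n, fsval B = A])) => C _.
by apply: sub_sigma_algebra; exists n, C.
Qed.

End partition_chain.

Theorem mainTheorem10 (R : realType) (T : ptopologicalType)
  (U : set (set T)) (As : set {fset (set T)})
  (Pi : forall a : {fset (set T)}, probability (borel (Rvec R a)) R) :
  polish R T ->
  countable U -> basis U ->
  (forall a, As a -> is_partition a /\ partition_generated_by U a) ->
  directed As -> resolves As ->
  (forall a, As a -> Pi a (simplex a) = 1%E) ->
  coherent As Pi ->
  ((exists Pi_ : probability (borel (M1t R T)) R,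
      [/\ radon Pi_, projects Pi_ As Pi &
          forall Pi' : probability (borel (M1t R T)) R,
            radon Pi' -> projects Pi' As Pi ->
            forall S : set (M1t R T), <<s @open (M1t R T) >> S -> Pi' S = Pi_ S])
   <->
   (forall eps delta : R, 0 < eps -> 0 < delta ->
      exists K : set (hatX U),
        compact K /\
        forall a, As a ->
          (Pi a [set p : Rvec R a |
                   (\sum_(A : a | `[< fsval A `&` K !=set0 >]) p A < 1 - delta)%R]
           < eps%:E)%E)).
Proof.
move=> pT cU bU Ap Adir Ares Pis coh; split.
  move=> [Q [rQ projQ _]] eps delta e0 d0.
  have [K [kK cK hK]] := mean_tight pT Q cU bU e0 d0.
  exists K; split => // a Aa; have [pa _] := Ap _ Aa.
  have mK := closed_borel cK.
  set S := [set p | _].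
  have mS : <<s @open (Rvec R a) >> S.
    by apply: sub_sigma_algebra; exact: Rvec_sum_lt_open.
  rewrite (projQ a Aa S mS); apply: le_lt_trans hK; apply: le_probability.
  - exact: (vecof_measurable pT pa mS).
  - by apply: measurable_mass_ge => //; apply: (@measurableC _ (borel T)).
  (* The hull contains [K] for every partition, so a single [K] works for all [a]. *)
  - move=> P; rewrite /S /= -hull_mass // massC //.
    have : mass K P <= mass (hull a K) P.
      apply: le_mass => //; last exact: sub_hull.
      by apply: (saturated_borel pa); exact: (@hull_saturated T a K pa).
    move: (mass _ _) (mass _ _) => x y; lra.
move=> tight.
have [b [Ab br cof]] := partition_chain cU Ap Adir.
have bp n : is_partition (b n) by have [] := Ap _ (Ab n).
have bhat n (A : b n) : hat_clopen U (fsval A) by exact: (generated_hat_clopen Ap A (Ab n)).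
have bgen := chain_resolves Ap Ares Ab cof.
have Pic : forall m n, (m <= n)%N -> forall S, <<s @open (Rvec R (b m)) >> S ->
    Pi (b m) S = Pi (b n) [set q | S (phi (b m) (b n) q)].
  by move=> m n mn S mS; apply: coh => //; exact: chain_refines.
have [Q [rQ QE]] : exists Q : probability (borel (M1t R T)) R,
    radon Q /\ forall n S, <<s @open (Rvec R (b n)) >> S ->
    Q [set P | S (vecof (b n) P)] = Pi (b n) S.
  apply: (chain_measure_exists pT cU bU bp br bhat bgen) => //.
  - by move=> n; exact: Pis.
  - move=> eps delta e0 d0; have [K [cK hK]] := tight _ _ e0 d0.
    by exists K; split => // n; exact: hK.
exists Q; split => //.
  (* Coherence transfers the identity from a level of the chain that refines [a]. *)
  move=> a Aa S mS; have [n an] := cof _ Aa; have [pa _] := Ap _ Aa.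
  rewrite (coh a (b n)) // -QE; last exact: phi_measurable.
  by congr (Q _); apply/funext => P /=; rewrite phi_vecof.
move=> Q' _ projQ' S.
rewrite (cylinders_gen pT cU bU bp br bgen).
(* The cylinders are stable under intersection and generate the Borel sets, so agreement on them
   suffices. *)
apply: (@g_sigma_algebra_measure_unique _ R (borel (M1t R T)) (@cylinders R T b) _
  (fun=> setT)).
- move=> C cC; rewrite /measurable /= (cylinders_gen pT cU bU bp br bgen).
  exact: sub_sigma_algebra.
- by move=> _; have [c0 _ cC] := @cylinders_algebra R T b bp br; rewrite -setC0; exact: cC.
- by apply/seteqP; split => // P _; exists 0%N.
- by apply: set_algebraI; exact: cylinders_algebra.
- by move=> _ [n [V [mV _ ->]]]; rewrite -[LHS](projQ' _ (Ab n) V mV); exact/esym/QE.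
- by move=> _; rewrite ltey_eq probability_fin.
Qed.
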